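(* Let $p\neq 2$ be a prime, let $K$ be a complete non-Archimedean valued field which is an extension of $\mathbb Q_p$ and whose absolute value extends the $p$-adic absolute value, and let $\mathcal B$ be a Banach space over $K$. Let $\mathfrak U_1(\mathbb Q_p)=\{1+z:\ z\in\mathbb Q_p,\ |z|<1\}$ be the multiplicative group of principal units of $\mathbb Q_p$. Let $U(s)$, $s\in\mathfrak U_1(\mathbb Q_p)$, be a norm continuous one-parameter group of unitary operators on $\mathcal B$, such that the spectrum of the strongly normal operator $U(1+p)-I$ is contained in $p\mathbb Z_p$. Then there exists a strongly normal operator $A$ on $\mathcal B$ with $\sigma(A)\subseteq\mathbb Z_p$ such that $U(s)=s^A$ for all $s\in\mathfrak U_1(\mathbb Q_p)$.
   Context: Let $L(\mathcal B)$ be the algebra of bounded linear operators on $\mathcal B$ with the operator norm, and $I$ the identity operator. For $A\in L(\mathcal B)$, $\sigma(A)$ denotes the spectrum of $A$, and $\mathcal L_A$ denotes the commutative Banach algebra generated by $A$ and $I$, i.e. the operator-norm closure in $L(\mathcal B)$ of the algebra $K[A]$ of polynomials in $A$. $\mathcal M(\mathcal L_A)$ denotes the Berkovich spectrum of $\mathcal L_A$: the set of all bounded multiplicative seminorms on $\mathcal L_A$, with its natural topology (the weakest one making all maps $x\mapsto |T|_x$, $T\in\mathcal L_A$, continuous); it is a nonempty compact Hausdorff space. Normal operator: $A$ is called normal if $\mathcal L_A$ is uniform, that is $\|T^2\|=\|T\|^2$ for all $T\in\mathcal L_A$, and all characters of $\mathcal L_A$ take values in $K$. Then $\mathcal M(\mathcal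 L_A)$ is totally disconnected and $\mathcal L_A$ is isometrically isomorphic to the algebra $C(\mathcal M(\mathcal L_A),K)$ of continuous $K$-valued functions with the supremum norm; the characteristic function of an open-closed set $\Lambda\subset\mathcal M(\mathcal L_A)$ corresponds to an idempotent operator $E(\Lambda)=E_A(\Lambda)\in\mathcal L_A$, and these form a finitely additive, norm-bounded projection-valued measure. Strongly normal operator: a normal operator $A$ is called strongly normal if its spectrum $\sigma(A)$ is a nonempty totally disconnected compact subset of $K$ and $\mathcal M(\mathcal L_A)=\sigma(A)$. Under this identification $\mathcal L_A\cong C(\sigma(A),K)$ isometrically, with $A$ corresponding to the function $\lambda\mapsto\lambda$. For a continuous function $\varphi:\sigma(A)\to K$, the operator $\varphi(A)=\int_{\sigma(A)}\varphi(\lambda)\,E_A(d\lambda)\in\mathcal L_A$ is the one corresponding to $\varphi$ under this isomorphism. Unitary operator: an operator $U$ on $\mathcal B$ is called unitary if $U=I+V$ where $V$ is strongly normal and $\|V\|<1$. Norm continuous one-parameter group of unitary operators (parametrized by $\mathfrak U_1(\mathbb Q_p)$): a family of unitary operators $U(s)$, $s\in\mathfrak U_1(\mathbb Q_p)$, such that $U(s_1s_2)=U(s_1)U(s_2)$ for all $s_1,s_2\in\mathfrak U_1(\mathbb Q_p)$, and $s\mapsto U(s)$ is continuous with respect to the operator norm. The operator $s^A$: for $s=1+z$ with $|z|<1$ and $\lambda\in\mathbb Z_p$, set $s^\lambda=(1+z)^\lambda=\sum_{n=0}^\infty z^nP_n(\lambda)$, where $P_0(\lambda)\equiv 1$ and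 $P_n(\lambda)=\frac{\lambda(\lambda-1)\cdots(\lambda-n+1)}{n!}$ for $n\ge 1$. For a strongly normal operator $A$ with $\sigma(A)\subseteq\mathbb Z_p$, $s^A=\int_{\sigma(A)}s^\lambda\,E_A(d\lambda)$, i.e. $s^A=\varphi(A)$ with $\varphi(\lambda)=s^\lambda$. *)

(* Defs.v *)
From HB Require Import structures.
From mathcomp Require Import all_boot all_order all_algebra.
From mathcomp Require Import all_classical all_reals all_analysis.

Set Implicit Arguments.
Unset Strict Implicit.
Unset Printing Implicit Defensive.

Import Order.TTheory GRing.Theory Num.Theory.
Import numFieldNormedType.Exports.

Local Open Scope classical_set_scope.
Local Open Scope ring_scope.

(* MathComp's norms (normedZmodType and its extensions) satisfy               *)
(* `|x *+ n| = `|x| *+ n and therefore exclude ultrametric norms. Absolute    *)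
(* values and norms are added here as real functions.                         *)

HB.mixin Record isNonArchValued (R : realType) K
    of GRing.Field K & Uniform K := {
  vabs : K -> R ;
  vabs_ge0 : forall x, 0 <= vabs x ;
  vabs_eq0 : forall x, (vabs x == 0) = (x == 0) ;
  vabsM : forall x y, vabs (x * y) = vabs x * vabs y ;
  vabs_ultra : forall x y, vabs (x + y) <= Num.max (vabs x) (vabs y) ;
  vabs_entourageE : @entourage K =
    entourage_ (fun (x : K) (e : R) => [set y : K | vabs (x - y) < e])
}.

#[short(type="valuedFieldType")]
HB.structure Definition ValuedField (R : realType) :=
  {K of GRing.Field K & Uniform K & isNonArchValued R K}.

(* Every Cauchy sequence for the distance N (x - y) converges. *)
Definition norm_complete (R : realType) (T : zmodType) (N : T -> R) : Prop :=
  forall u : nat -> T,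
    (forall e : R, 0 < e -> exists k, forall m n, (k <= m)%N -> (k <= n)%N ->
       N (u m - u n) < e) ->
    exists l : T, forall e : R, 0 < e -> exists k, forall n, (k <= n)%N ->
       N (u n - l) < e.

HB.mixin Record isCompleteValued (R : realType) K of ValuedField R K := {
  vabs_complete : norm_complete (@vabs R K)
}.

#[short(type="completeValuedFieldType")]
HB.structure Definition CompleteValuedField (R : realType) :=
  {K of ValuedField R K & isCompleteValued R K}.

HB.mixin Record isUltraNormed (R : realType) (K : valuedFieldType R) B
    of GRing.Lmodule K B := {
  unorm : B -> R ;
  unorm_ge0 : forall x, 0 <= unorm x ;
  unorm_eq0 : forall x, (unorm x == 0) = (x == 0) ;
  unormZ : forall (a : K) x, unorm (a *: x) = vabs a * unorm x ;
  unorm_ultra : forall x y, unorm (x + y) <= Num.max (unorm x) (unorm y)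
}.

#[short(type="ultraNormedType")]
HB.structure Definition UltraNormed (R : realType) (K : valuedFieldType R) :=
  {B of GRing.Lmodule K B & isUltraNormed R K B}.

HB.mixin Record isUltraBanach (R : realType) (K : valuedFieldType R) B
    of UltraNormed R K B := {
  unorm_complete : norm_complete (@unorm R K B)
}.

#[short(type="ultraBanachType")]
HB.structure Definition UltraBanach (R : realType) (K : valuedFieldType R) :=
  {B of UltraNormed R K B & isUltraBanach R K B}.

Section BoundedOperators.
Variables (R : realType) (K : valuedFieldType R) (B : ultraNormedType K).

Definition bounded_linear : {pred B -> B} := fun f =>
  `[< linear f /\ exists C : R, forall x, unorm (f x) <= C * unorm x >].

Record bop := Bop { bop_fun :> B -> B ; bopP : bop_fun \in bounded_linear }.

HB.instance Definition _ := [isSub for bop_fun].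
HB.instance Definition _ := [Choice of bop by <:].

Lemma unorm0 : unorm (0 : B) = 0.
Proof. by apply/eqP; rewrite unorm_eq0. Qed.

Lemma vabs1 : vabs (1 : K) = 1.
Proof.
have h : vabs (1 : K) != 0 by rewrite vabs_eq0 oner_eq0.
by apply: (mulfI h); rewrite mulr1 -vabsM mulr1.
Qed.

Lemma vabsN1 : vabs (-1 : K) = 1.
Proof.
have : vabs (-1 : K) ^+ 2 = 1 by rewrite expr2 -vabsM mulrNN mulr1 vabs1.
by move/eqP; rewrite sqrp_eq1 ?vabs_ge0// => /eqP.
Qed.

Lemma unormN (x : B) : unorm (- x) = unorm x.
Proof. by rewrite -scaleN1r unormZ vabsN1 mul1r. Qed.

Lemma bounded_linear_submod_closed : submod_closed bounded_linear.
Proof.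
split.
  apply/asboolP; split; first by move=> a x y; rewrite scaler0 addr0.
  by exists 0 => x; rewrite mul0r unorm0.
move=> a f g /asboolP[fl [C fC]] /asboolP[gl [D gD]]; apply/asboolP; split.
  move=> b x y /=; rewrite !fctE fl gl !scalerDr -!addrA; congr (_ + _).
    by rewrite !scalerA mulrC.
  by rewrite addrCA.
exists (Num.max (vabs a * C) D) => x.
rewrite (le_trans (unorm_ultra _ _))//.
rewrite ge_max maxr_pMl ?unorm_ge0// !le_max; apply/andP; split.
  by rewrite unormZ -mulrA ler_wpM2l ?vabs_ge0// fC.
by rewrite gD orbT.
Qed.

HB.instance Definition _ := GRing.isSubmodClosed.Build K (B -> B) bounded_linear
  bounded_linear_submod_closed.
HB.instance Definition _ := [SubChoice_isSubLmodule of bop by <:].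

Lemma bop_eq (S T : bop) : (forall x, S x = T x) -> S = T.
Proof. by move=> h; apply/val_inj/funext. Qed.

Lemma bopDE (S T : bop) x : (S + T) x = S x + T x. Proof. by []. Qed.
Lemma bopNE (T : bop) x : (- T) x = - T x. Proof. by []. Qed.
Lemma bopZE a (T : bop) x : (a *: T) x = a *: T x. Proof. by []. Qed.

Lemma bop_linear (T : bop) : linear T.
Proof. by case: T => f /= /asboolP[]. Qed.

Lemma bop_add (T : bop) x y : T (x + y) = T x + T y.
Proof. by have := bop_linear T 1 x y; rewrite !scale1r. Qed.

Lemma bop_bounded (T : bop) :
  exists2 C : R, 0 <= C & forall x, unorm (T x) <= C * unorm x.
Proof.
case: T => f /= /asboolP[_ [C fC]]; exists (Num.max 0 C).
  by rewrite le_max lexx.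
by move=> x; rewrite (le_trans (fC x))// ler_wpM2r ?unorm_ge0// le_max lexx orbT.
Qed.

Lemma bop_one_subproof : (idfun : B -> B) \in bounded_linear.
Proof.
by apply/asboolP; split => //; exists 1 => x; rewrite mul1r.
Qed.
Definition bop_one := Bop bop_one_subproof.

Lemma bop_mul_subproof (S T : bop) : (S \o T : B -> B) \in bounded_linear.
Proof.
apply/asboolP; split; first by move=> a x y; rewrite /= !bop_linear.
have [C C0 SC] := bop_bounded S; have [D D0 TD] := bop_bounded T.
exists (C * D) => x /=; rewrite (le_trans (SC _))// -mulrA.
by rewrite ler_wpM2l.
Qed.
Definition bop_mul (S T : bop) := Bop (bop_mul_subproof S T).

(* Only a pzRingType: 1 = 0 in bop when B is the zero space. *)
HB.instance Definition _ := GRing.Zmodule_isPzRing.Build bop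
  (fun S T U : bop => bop_eq (fun x => erefl :
     bop_mul S (bop_mul T U) x = bop_mul (bop_mul S T) U x))
  (fun T : bop => bop_eq (fun x => erefl : bop_mul bop_one T x = T x))
  (fun T : bop => bop_eq (fun x => erefl : bop_mul T bop_one x = T x))
  (fun S T U : bop => bop_eq (fun x => erefl :
     bop_mul (S + T) U x = (bop_mul S U + bop_mul T U) x))
  (fun S T U : bop => bop_eq (fun x => bop_add S (T x) (U x) :
     bop_mul S (T + U) x = (bop_mul S T + bop_mul S U) x)).

(* The point x = 0 contributes 0 / 0 = 0. *)
Definition opnorm (T : bop) : R :=
  sup (range (fun x : B => unorm (T x) / unorm x)).

Lemma opnorm_has_sup (T : bop) :
  has_sup (range (fun x : B => unorm (T x) / unorm x)).
Proof.
split; first by exists (unorm (T 0) / unorm (0 : B)), 0.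
have [C C0 TC] := bop_bounded T; exists C => _ [x _ <-].
have [->|x0] := eqVneq x 0; first by rewrite unorm0 invr0 mulr0.
by rewrite ler_pdivrMr ?TC// lt_neqAle eq_sym unorm_eq0 x0 unorm_ge0.
Qed.

Lemma opnorm_ge0 (T : bop) : 0 <= opnorm T.
Proof.
apply: ub_le_sup; first by have [] := opnorm_has_sup T.
by exists 0 => //; rewrite unorm0 invr0 mulr0.
Qed.

Lemma opnorm_ub (T : bop) x : unorm (T x) <= opnorm T * unorm x.
Proof.
have [->|x0] := eqVneq x 0.
  by have [C _ /(_ 0)] := bop_bounded T; rewrite unorm0 !mulr0.
rewrite -ler_pdivrMr ?lt_neqAle 1?eq_sym ?unorm_eq0 ?x0 ?unorm_ge0//.
apply: ub_le_sup; first by have [] := opnorm_has_sup T.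
by exists x.
Qed.

Lemma opnorm_le (T : bop) C : 0 <= C -> (forall x, unorm (T x) <= C * unorm x) ->
  opnorm T <= C.
Proof.
move=> C0 TC; apply: ge_sup; first by have [] := opnorm_has_sup T.
move=> _ [x _ <-].
have [->|x0] := eqVneq x 0; first by rewrite unorm0 invr0 mulr0.
by rewrite ler_pdivrMr ?TC// lt_neqAle eq_sym unorm_eq0 x0 unorm_ge0.
Qed.

Lemma opnorm_eq0 (T : bop) : (opnorm T == 0) = (T == 0).
Proof.
apply/eqP/eqP => [T0|->].
  apply: bop_eq => x; apply/eqP; rewrite -unorm_eq0 eq_le unorm_ge0 andbT.
  by rewrite (le_trans (opnorm_ub _ _))// T0 mul0r.
apply/eqP; rewrite eq_le opnorm_ge0 andbT; apply: opnorm_le => // x.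
by rewrite mul0r unorm0.
Qed.

Lemma opnorm_scale_le a (T : bop) : opnorm (a *: T) <= vabs a * opnorm T.
Proof.
apply: opnorm_le => [|x]; first by rewrite mulr_ge0 ?vabs_ge0 ?opnorm_ge0.
by rewrite bopZE unormZ -mulrA ler_wpM2l ?vabs_ge0 ?opnorm_ub.
Qed.

Lemma opnormZ a (T : bop) : opnorm (a *: T) = vabs a * opnorm T.
Proof.
apply/eqP; rewrite eq_le opnorm_scale_le/=.
have [->|a0] := eqVneq a 0.
  by rewrite (eqP (_ : vabs 0 == 0)) ?vabs_eq0// mul0r opnorm_ge0.
have va : 0 < vabs a by rewrite lt_neqAle eq_sym vabs_eq0 a0 vabs_ge0.
rewrite -ler_pdivlMl// -[in leLHS](scalerK a0 T).
rewrite (le_trans (opnorm_scale_le _ _))// ler_wpM2r ?opnorm_ge0//.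
rewrite -[leRHS]mulr1 ler_pdivlMl//.
by rewrite -vabsM divff// vabs1.
Qed.

Lemma opnorm_ultra (S T : bop) : opnorm (S + T) <= Num.max (opnorm S) (opnorm T).
Proof.
apply: opnorm_le => [|x]; first by rewrite le_max opnorm_ge0.
rewrite (le_trans (unorm_ultra _ _))// maxr_pMl ?unorm_ge0//.
by rewrite ge_max !le_max !opnorm_ub orbT.
Qed.

Definition opball (S : bop) (e : R) : set bop := [set T | opnorm (S - T) < e].

HB.instance Definition _ := hasNbhs.Build bop (nbhs_ (entourage_ opball)).

Lemma opball_center (S : bop) (e : R) : 0 < e -> opball S e S.
Proof. by move=> e0; rewrite /opball/= subrr (eqP (_ : opnorm 0 == 0)) ?opnorm_eq0. Qed.

Lemma opball_sym (S T : bop) (e : R) : opball S e T -> opball T e S.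
Proof.
rewrite /opball/= -opprB -(scaleN1r (T - S)) opnormZ.
by rewrite vabsN1 mul1r.
Qed.

Lemma opball_triangle (S T U : bop) (e1 e2 : R) :
  opball S e1 T -> opball T e2 U -> opball S (e1 + e2) U.
Proof.
rewrite /opball/= => h1 h2.
rewrite -(subrK T S) -addrA (le_lt_trans (opnorm_ultra _ _))// gt_max.
by rewrite (lt_le_trans h1) ?(lt_le_trans h2)//
  ?lerDl ?lerDr ?(le_trans (opnorm_ge0 _) (ltW h1)) ?(le_trans (opnorm_ge0 _) (ltW h2)).
Qed.

HB.instance Definition _ := @Nbhs_isPseudoMetric.Build R bop
  (entourage_ opball) erefl opball opball_center opball_sym opball_triangle erefl.

HB.instance Definition _ := @isUltraNormed.Build R K bop opnorm
  opnorm_ge0 opnorm_eq0 opnormZ opnorm_ultra.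

Definition spectrum (A : bop) : set K :=
  [set l : K | ~ exists S : bop, S * (A - l *: (1 : bop)) = 1 /\ (A - l *: (1 : bop)) * S = 1].

Definition poly_op (A : bop) (P : {poly K}) : bop :=
  \sum_(i < size P) P`_i *: A ^+ i.

(* The Banach algebra generated by A and the identity. *)
Definition opalg (A : bop) : set bop := closure (range (poly_op A)).

(* A seminorm on the subalgebra D is encoded as a function on all of bop that *)
(* vanishes off D, so that distinct seminorms on D are distinct points and    *)
(* the topology of pointwise convergence is that of the evaluations at the    *)
(* elements of D. Multiplicativity on the scalars need not be assumed: it     *)
(* follows from boundedness.                                                  *)
Record bounded_mult_seminorm (D : set bop) (x : bop -> R) : Prop := {
  bms_out : forall T, ~ D T -> x T = 0 ;
  bms_ge0 : forall T, D T -> 0 <= x T ;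
  bms0 : x 0 = 0 ;
  bms1 : x 1 = 1 ;
  bmsB : forall S T, D S -> D T -> x (S - T) <= x S + x T ;
  bmsM : forall S T, D S -> D T -> x (S * T) = x S * x T ;
  bms_bounded : exists C : R, forall T, D T -> x T <= C * unorm T
}.

Definition berkovich_spectrum (D : set bop) : set {ptws bop -> R} :=
  [set x | bounded_mult_seminorm D x].

Record is_character (F : valuedFieldType R) (j : K -> F) (D : set bop)
    (chi : bop -> F) : Prop := {
  char1 : chi 1 = 1 ;
  charD : forall S T, D S -> D T -> chi (S + T) = chi S + chi T ;
  charM : forall S T, D S -> D T -> chi (S * T) = chi S * chi T ;
  charZ : forall a T, D T -> chi (a *: T) = j a * chi T ;
  char_bounded : exists C : R, forall T, D T -> vabs (chi T) <= C * unorm T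
}.

(* A priori a character takes its values in a complete valued extension of K. *)
Definition characters_in_base (D : set bop) : Prop :=
  forall (F : completeValuedFieldType R) (j : {rmorphism K -> F}),
    (forall a, vabs (j a) = vabs a) ->
    forall chi : bop -> F, is_character j D chi ->
    forall T, D T -> exists a : K, chi T = j a.

Definition uniform_alg (D : set bop) : Prop :=
  forall T, D T -> unorm (T ^+ 2) = unorm T ^+ 2.

Definition normal (A : bop) : Prop :=
  uniform_alg (opalg A) /\ characters_in_base (opalg A).

(* The equality of the Berkovich spectrum of opalg A with spectrum A: they    *)
(* are homeomorphic by h, where the function A takes the value l at the point *)
(* h l, i.e. A - l vanishes there.                                            *)
Definition berkovich_is_spectrum (A : bop) : Prop :=
  exists (h : K -> {ptws bop -> R}) (g : {ptws bop -> R} -> K),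
    [/\ {homo h : l / spectrum A l >-> berkovich_spectrum (opalg A) l},
        {homo g : x / berkovich_spectrum (opalg A) x >-> spectrum A x},
        (forall l, spectrum A l -> g (h l) = l),
        (forall x, berkovich_spectrum (opalg A) x -> h (g x) = x) &
    [/\ {within spectrum A, continuous h},
        {within berkovich_spectrum (opalg A), continuous g} &
        forall l, spectrum A l -> h l (A - l *: (1 : bop)) = 0]].

Definition strongly_normal (A : bop) : Prop :=
  [/\ normal A, spectrum A !=set0, compact (spectrum A),
      totally_disconnected (spectrum A) & berkovich_is_spectrum A].

(* An isometric isomorphism G of opalg A onto the algebra of continuous       *)
(* K-valued functions on spectrum A (functions on K, considered on spectrum A *)
(* only) that sends A to the function l |-> l. Injectivity is contained in    *)
(* the isometry.                                                              *)
Record spectral_iso (A : bop) (G : bop -> K -> K) : Prop := {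
  siso_cont : forall T, opalg A T -> {within spectrum A, continuous (G T)} ;
  siso1 : forall l, spectrum A l -> G 1 l = 1 ;
  sisoD : forall S T, opalg A S -> opalg A T ->
    forall l, spectrum A l -> G (S + T) l = G S l + G T l ;
  sisoM : forall S T, opalg A S -> opalg A T ->
    forall l, spectrum A l -> G (S * T) l = G S l * G T l ;
  sisoZ : forall a T, opalg A T ->
    forall l, spectrum A l -> G (a *: T) l = a * G T l ;
  siso_norm : forall T, opalg A T ->
    unorm T = sup [set vabs (G T l) | l in spectrum A] ;
  siso_surj : forall phi : K -> K, {within spectrum A, continuous phi} ->
    exists2 T, opalg A T & forall l, spectrum A l -> G T l = phi l ;
  siso_id : forall l, spectrum A l -> G A l = l
}.

(* T = phi(A) *)
Definition op_fun_calc (A : bop) (phi : K -> K) (T : bop) : Prop :=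
  exists2 G, spectral_iso A G &
    {within spectrum A, continuous phi} /\
    (opalg A T /\ forall l, spectrum A l -> G T l = phi l).

Definition unitary (U : bop) : Prop :=
  exists V : bop, [/\ strongly_normal V, unorm V < 1 & U = 1 + V].

End BoundedOperators.

Section PadicPowers.
Variables (R : realType) (K : valuedFieldType R).

Definition binom_poly (n : nat) (l : K) : K :=
  (\prod_(i < n) (l - i%:R)) / n`!%:R.

(* s ^ l = sum_n (s - 1) ^ n binom(l, n); the default value 0 is taken only    *)
(* where the series diverges.                                                 *)
Definition vpow (s l : K) : K :=
  xget 0 [set t | series (fun n => (s - 1) ^+ n * binom_poly n l) @ \oo --> t].

End PadicPowers.

Section PadicNumbers.
Variable R : realType.

Definition padic_abs (p : nat) (q : rat) : R :=
  if q == 0 then 0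
  else p%:R ^ ((logn p `|denq q|)%:Z - (logn p `|numq q|)%:Z).

(* Qp is the completion of rat for the p-adic absolute value. *)
Definition is_padic_field (p : nat) (Qp : completeValuedFieldType R) : Prop :=
  (forall q : rat, vabs (ratr q : Qp) = padic_abs p q) /\
  dense (range (ratr : rat -> Qp)).

Variable Qp : valuedFieldType R.

Definition padic_int : set Qp := [set x | vabs x <= 1].

Definition principal_units : set Qp := [set 1 + z | z in [set z | vabs z < 1]].

Definition unitary_group (K : valuedFieldType R) (B : ultraNormedType K)
    (U : Qp -> bop B) : Prop :=
  [/\ forall s, principal_units s -> unitary (U s),
      forall s t, principal_units s -> principal_units t ->
        U (s * t) = U s * U t &
      {within principal_units, continuous U}].

End PadicNumbers.

(* Main.v *)
Require Import Defs.
From HB Require Import structures.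
From mathcomp Require Import all_boot all_order all_algebra.
From mathcomp Require Import all_classical all_reals all_analysis.
From mathcomp Require Import cyclic zify ring.

Set Implicit Arguments.
Unset Strict Implicit.
Unset Printing Implicit Defensive.

Import Order.TTheory GRing.Theory Num.Theory.
Import numFieldNormedType.Exports.

Local Open Scope classical_set_scope.
Local Open Scope ring_scope.

(** Put V = U(1 + p) - 1, so that 1 + V = U(1 + p). The operator A is the
    logarithm of 1 + V to the base 1 + p: for an odd prime p, the map
    m |-> (1 + p) ^ m is a homeomorphism of the p-adic integers onto the units
    congruent to 1 modulo p, because
    (1 + p) ^ (p ^ k) is congruent to 1 + p ^ k.+1 modulo p ^ k.+2
    (vpow_1p_surj, vpow_1p_inj). Its inverse gives a continuous function psi on
    the spectrum of V with (1 + p) ^ psi(l) = 1 + l, and A = psi(V).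

    That psi(V) makes sense is the functional calculus for a strongly normal
    operator whose spectrum consists of p-adic integers. A point l of the
    spectrum of V gives a multiplicative seminorm on the algebra of V which
    vanishes at V - l, and the Gelfand transform of T at l is the scalar a for
    which it vanishes at T - a. This is an isometry: the norm is power
    multiplicative, and for each T a minimal uniform seminorm that keeps the
    value at T is multiplicative (multiplicative_seminorm_attaining), hence is
    a point of the Berkovich spectrum, which is the spectrum of V. It is onto
    the continuous functions because the indicators of balls are uniform limits
    of polynomials, by the theorem of Euler on p ^ n (gelfand_surjective).

    Conversely 1 + V is the sum of the series of the operators
    p ^ n binomial(A, n), since the series of (1 + p) ^ m converges uniformly in
    the p-adic integer m. Therefore A and V generate the same algebra, and A is
    strongly normal along with V (strongly_normal_generator). Finally, the
    powers (1 + p) ^ n with n a natural number are dense in the group of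
    principal units; there U(s) = s ^ A because U is multiplicative, and both
    sides are continuous in s. *)

(** * Ultrametric estimates *)

Section ValuedField.
Variables (R : realType) (K : valuedFieldType R).
Implicit Types (x y z : K) (c e : R).

Lemma vabs0 : vabs (0 : K) = 0.
Proof. by apply/eqP; rewrite vabs_eq0. Qed.

Lemma vabs_gt0 x : (0 < vabs x) = (x != 0).
Proof. by rewrite lt_neqAle vabs_ge0 andbT eq_sym vabs_eq0. Qed.

Lemma vabsN x : vabs (- x) = vabs x.
Proof. by rewrite -mulN1r vabsM vabsN1 mul1r. Qed.

Lemma vdistC x y : vabs (x - y) = vabs (y - x).
Proof. by rewrite -vabsN opprB. Qed.

Lemma vabsV x : vabs x^-1 = (vabs x)^-1.
Proof.
have [->|x0] := eqVneq x 0; first by rewrite !(invr0, vabs0).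
apply: (mulfI (_ : vabs x != 0)); first by rewrite vabs_eq0.
by rewrite -vabsM !divff ?vabs_eq0// vabs1.
Qed.

Lemma vabsX x n : vabs (x ^+ n) = vabs x ^+ n.
Proof. by elim: n => [|n IH]; rewrite ?vabs1// !exprS vabsM IH. Qed.

Lemma vabsD_le c x y : vabs x <= c -> vabs y <= c -> vabs (x + y) <= c.
Proof. by move=> xc yc; rewrite (le_trans (vabs_ultra _ _))// ge_max xc. Qed.

Lemma vabsB_le c x y : vabs x <= c -> vabs y <= c -> vabs (x - y) <= c.
Proof. by move=> xc yc; apply: vabsD_le; rewrite ?vabsN. Qed.

Lemma vdist_trans y c x z :
  vabs (x - y) <= c -> vabs (y - z) <= c -> vabs (x - z) <= c.
Proof. by move=> xy yz; rewrite -(subrK y x) -addrA vabsD_le. Qed.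

Lemma vabsD_lt c x y : vabs x < c -> vabs y < c -> vabs (x + y) < c.
Proof. by move=> xc yc; rewrite (le_lt_trans (vabs_ultra _ _))// gt_max xc. Qed.

Lemma vdist_lt_trans y c x z :
  vabs (x - y) < c -> vabs (y - z) < c -> vabs (x - z) < c.
Proof. by move=> xy yz; rewrite -(subrK y x) -addrA vabsD_lt. Qed.

Lemma vabs_le_dist c x y : vabs (x - y) <= c -> vabs y <= c -> vabs x <= c.
Proof. by move=> xy yc; rewrite -(subrK y x) vabsD_le. Qed.

Lemma vabs_dominant x y : vabs (x - y) < vabs y -> vabs x = vabs y.
Proof.
move=> xy; apply/eqP; rewrite eq_le (vabs_le_dist (ltW xy))//= leNgt.
apply/negP => xlty; suff : vabs y < vabs y by rewrite ltxx.
by rewrite -[X in vabs X < _](subKr x y) vabsD_lt// vabsN.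
Qed.

Lemma vabs_sum I (s : seq I) (P : pred I) (F : I -> K) c :
  0 <= c -> (forall i, P i -> vabs (F i) <= c) ->
  vabs (\sum_(i <- s | P i) F i) <= c.
Proof.
by move=> c0 Fc; elim/big_ind: _ => // [|x y]; [rewrite vabs0 | exact: vabsD_le].
Qed.

Lemma vabs_nat n : vabs (n%:R : K) <= 1.
Proof.
by elim: n => [|n IH]; rewrite ?vabs0 ?ler01// -natr1 vabsD_le// vabs1.
Qed.

Lemma vabs_small_eq0 x : (forall e, 0 < e -> vabs x <= e) -> x = 0.
Proof.
move=> h; apply/eqP; rewrite -vabs_eq0 eq_le vabs_ge0 andbT.
by apply/ler_addgt0Pl => e e0; rewrite addr0 h.
Qed.

Lemma exprn_ile1_le (r : R) m n : 0 <= r -> r <= 1 -> (m <= n)%N -> r ^+ n <= r ^+ m.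
Proof. by move=> r0 r1 mn; apply: ler_wiXn2l. Qed.

Lemma expr_small (r e : R) : 0 <= r -> r < 1 -> 0 < e ->
  exists N, forall n, (N <= n)%N -> r ^+ n < e.
Proof.
move=> r0 r1 e0; have : `|r| < 1 by rewrite ger0_norm.
move=> /(@cvg_expr R)/(@cvgrPdist_lt _ R^o _) /(_ e e0)[N _ h]; exists N => n Nn.
by have := h n Nn; rewrite /= sub0r normrN ger0_norm// exprn_ge0.
Qed.

Lemma vabs_subrXX x y n : vabs x <= 1 -> vabs y <= 1 ->
  vabs (x ^+ n - y ^+ n) <= vabs (x - y).
Proof.
move=> x1 y1; rewrite subrXX vabsM ler_piMr ?vabs_ge0//.
apply: vabs_sum => // i _; rewrite vabsM !vabsX.
by rewrite mulr_ile1 ?exprn_ge0 ?exprn_ile1 ?vabs_ge0.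
Qed.

Lemma vnbhsP x (A : set K) :
  nbhs x A <-> exists2 e : R, 0 < e & forall y, vabs (x - y) < e -> A y.
Proof.
rewrite -nbhs_entourageE vabs_entourageE; split.
  case=> E [e /= e0 eE] EA; exists e => // y xy.
  by apply: EA; apply/mem_set; apply: eE.
case=> e e0 h; exists [set xy | vabs (xy.1 - xy.2) < e]; first by exists e.
by move=> y /set_mem /h.
Qed.

Lemma vcvgP (F : set_system K) x : Filter F ->
  (F --> x) <-> forall e, 0 < e -> F [set y | vabs (x - y) < e].
Proof.
move=> FF; split => [Fx e e0|h A /vnbhsP[e e0 eA]].
  by apply: Fx; apply/vnbhsP; exists e.
by apply: filterS (h _ e0).
Qed.

Lemma within_continuousP (A : set K) (f : K -> K) :
  {within A, continuous f} <->
  forall x, A x -> forall e, 0 < e -> exists2 d : R, 0 < d &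
    forall y, A y -> vabs (x - y) < d -> vabs (f x - f y) < e.
Proof.
rewrite subspace_continuousP; split.
  move=> h x Ax e e0; have /vcvgP /(_ e e0) := h x Ax.
  rewrite /within/= => /vnbhsP[d d0 dh]; exists d => // y Ay xy.
  exact: dh.
move=> h x Ax; apply/vcvgP => e e0; have [d d0 dh] := h x Ax e e0.
by rewrite /within/=; apply/vnbhsP; exists d => // y xy Ay; exact: dh.
Qed.

Lemma within_uniform_limit (A : set K) (f : K -> K) :
  (forall e, 0 < e -> exists2 g : K -> K, {within A, continuous g} &
     forall x, A x -> vabs (f x - g x) < e) ->
  {within A, continuous f}.
Proof.
move=> h; apply/within_continuousP => x Ax e e0.
have [g /within_continuousP gc fg] := h e e0; have [d d0 dh] := gc x Ax e e0.
exists d => // y Ay xy; apply: (vdist_lt_trans (fg _ Ax)).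
by apply: (vdist_lt_trans (dh y Ay xy)); rewrite vdistC fg.
Qed.

Lemma compact_uniformly_continuous (A : set K) (f : K -> K) :
  compact A -> {within A, continuous f} -> forall e, 0 < e ->
  exists2 d : R, 0 < d &
    forall x y, A x -> A y -> vabs (x - y) < d -> vabs (f x - f y) < e.
Proof.
move=> /compact_near_coveringP cA /within_continuousP fc e e0.
have := cA R 0^'+
  (fun d x => A x -> forall y, A y -> vabs (x - y) < d -> vabs (f x - f y) < e) _.
case=> [x Ax|d /= d0 h].
  have [d d0 dh] := fc x Ax e e0.
  exists ([set y | vabs (x - y) < d], [set t | t < d]).
    split=> /=; first by apply/vnbhsP; exists d.
    exact: nbhs_right_lt.
  move=> [y t] [/= xy td] Ay z Az yz.
  apply: (@vdist_lt_trans (f x)); first by rewrite vdistC; exact: dh.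
  by apply: dh => //; apply: (vdist_lt_trans xy); rewrite (lt_trans yz).
exists (d / 2); first by rewrite divr_gt0.
move=> x y Ax Ay; apply: (h (d / 2)) => //=; last by rewrite divr_gt0.
by rewrite sub0r normrN gtr0_norm ?divr_gt0// ltr_pdivrMr// ltr_pMr// ltr1n.
Qed.

Lemma horner_within_continuous (A : set K) (P : {poly K}) : {within A, continuous (horner P)}.
Proof.
apply/within_continuousP => l sl; elim/poly_ind: P => [|P c IH] e e0.
  by exists 1 => // y _ _; rewrite !horner0 subrr vabs0.
pose M := vabs l + vabs P.[l] + 1.
have M0 : 0 < M by rewrite ltr_wpDl ?addr_ge0 ?vabs_ge0.
have lM : vabs l < M by rewrite /M -addrA ltrDl ltr_wpDl ?vabs_ge0.
have PM : vabs P.[l] < M by rewrite /M [vabs l + _]addrC -addrA ltrDl ltr_wpDl ?vabs_ge0.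
have [d d0 dh] := IH _ (divr_gt0 e0 M0).
exists (Num.min d (Num.min (e / M) M)).
  by rewrite !lt_min d0 M0 divr_gt0.
move=> y Ay; rewrite !lt_min => /and3P[/(dh y Ay) Pd ld lM'].
have yM : vabs y <= M.
  by rewrite -[y](subKr l) vabsB_le// ltW.
rewrite !hornerMXaddC opprD addrACA subrr addr0.
have -> : P.[l] * l - P.[y] * y = P.[l] * (l - y) + (P.[l] - P.[y]) * y by ring.
apply: vabsD_lt; rewrite vabsM.
  rewrite (le_lt_trans (ler_wpM2r (vabs_ge0 _) (ltW PM)))//.
  by rewrite mulrC -ltr_pdivlMr.
rewrite (le_lt_trans (ler_wpM2l (vabs_ge0 _) yM))//.
by rewrite -ltr_pdivlMr.
Qed.

Lemma within_continuousV (A : set K) (f : K -> K) :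
  {within A, continuous f} -> (forall x, A x -> f x != 0) ->
  {within A, continuous (fun x => (f x)^-1)}.
Proof.
move=> /within_continuousP fc f0; apply/within_continuousP => x Ax e e0.
have fx := f0 x Ax; have fx0 : 0 < vabs (f x) by rewrite vabs_gt0.
have m0 : 0 < Num.min (vabs (f x)) (e * vabs (f x) ^+ 2).
  by rewrite lt_min fx0 mulr_gt0 ?exprn_gt0.
have [d d0 dh] := fc x Ax _ m0; exists d => // y Ay /(dh y Ay).
rewrite lt_min => /andP[fxy fxye].
have fyE : vabs (f y) = vabs (f x) by apply: vabs_dominant; rewrite vdistC.
have -> : (f x)^-1 - (f y)^-1 = - (f x - f y) / (f x * f y).
  by field; rewrite fx f0.
by rewrite vabsM vabsN vabsV vabsM fyE ltr_pdivrMr ?mulr_gt0// -expr2.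
Qed.

(** The ball around one point of a connected set whose radius is the distance
    to another one is open and closed, and separates the two. *)
Lemma ultrametric_totally_disconnected (A : set K) : totally_disconnected A.
Proof.
move=> x Ax; rewrite eqEsubset; split=> y; last first.
  by move=> ->; exists [set x] => //; split=> // [_ ->|]; last exact: connected1.
case=> C [Cx CA Cc] Cy; apply: contrapT => /eqP; rewrite -subr_eq0 => yx.
pose B := C `&` [set z | vabs (z - x) < vabs (y - x)].
suff : B = C by move/seteqP => [_ /(_ y Cy)[_ /=]]; rewrite ltxx.
have opn (z t : K) : vabs (t - z) < vabs (y - x) ->
    (vabs (t - x) < vabs (y - x)) = (vabs (z - x) < vabs (y - x)).
  move=> tz; apply/idP/idP => h; last exact: vdist_lt_trans h.
  by apply: vdist_lt_trans h; rewrite vdistC.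
have yx0 : 0 < vabs (y - x) by rewrite vabs_gt0.
apply: Cc; first by exists x; split=> //=; rewrite subrr vabs0.
  exists [set z | vabs (z - x) < vabs (y - x)] => //.
  rewrite openE => z /= zx; apply/vnbhsP; exists (vabs (y - x)) => // t tz.
  by rewrite /= (opn z)// vdistC.
exists [set z | vabs (z - x) < vabs (y - x)] => //.
move=> z zc /=; have : nbhs z [set t | vabs (t - z) < vabs (y - x)].
  by apply/vnbhsP; exists (vabs (y - x)) => // t; rewrite /= vdistC.
by move=> /zc[t [/= tx tz]]; rewrite -(opn z t).
Qed.

End ValuedField.

(** * The closure of the natural numbers in a field of residue characteristic p *)

Section PadicIntegers.
Variables (R : realType) (K : completeValuedFieldType R) (p : nat).
Hypotheses (p_prime : prime p) (p_lt1 : vabs (p%:R : K) < 1)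
           (p_neq0 : p%:R != 0 :> K).
Local Notation r := (vabs (p%:R : K)).
Implicit Types (x y z l : K) (k m n : nat).

(** The closure of the natural numbers. In a field that contains the p-adic
    numbers these are the p-adic integers, without reference to the embedding:
    see iota_zp and zp_iota. *)
Definition zp x : Prop := forall k, exists m : nat, vabs (x - m%:R) <= r ^+ k.

Let r_gt0 : 0 < r. Proof. by rewrite vabs_gt0. Qed.
Let r_ge0 : 0 <= r. Proof. exact: ltW. Qed.
Let r_le1 : r <= 1. Proof. exact: ltW. Qed.
Let p_gt0 : (0 < p)%N. Proof. exact: prime_gt0. Qed.

Let rX_gt0 k : 0 < r ^+ k. Proof. exact: exprn_gt0. Qed.
Let rX_ge0 k : 0 <= r ^+ k. Proof. exact: ltW. Qed.

Lemma r_small e : 0 < e -> exists k, r ^+ k < e.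
Proof. by move=> /(expr_small r_ge0 p_lt1)[N /(_ _ (leqnn N))]; exists N. Qed.

Lemma vabs_coprime m : coprime p m -> vabs (m%:R : K) = 1.
Proof.
move=> pm; apply/eqP; rewrite eq_le vabs_nat/=.
have m0 : (0 < m)%N.
  by case: m pm => //; rewrite /coprime gcdn0 => /eqP pe; have := prime_gt1 p_prime; rewrite pe.
case: (egcdnP p m0) => a b ab _; move: pm; rewrite coprime_sym /coprime => /eqP mp.
have am : vabs ((a * m)%:R : K) = 1.
  rewrite -[RHS](vabs1 K); apply: vabs_dominant.
  rewrite ab mp natrD addrK vabs1 natrM vabsM (le_lt_trans _ p_lt1)//.
  by rewrite ler_piMl// vabs_nat.
by rewrite -am natrM vabsM ler_piMl ?vabs_ge0// vabs_nat.
Qed.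

(** On the natural numbers the absolute value is p-adic up to normalization:
    by Bezout, numbers prime to p have absolute value 1. *)
Lemma dvdn_vabs k m : (p ^ k %| m)%N = (vabs (m%:R : K) <= r ^+ k).
Proof.
apply/idP/idP => [/dvdnP[c ->]|].
  by rewrite natrM natrX vabsM vabsX ler_piMl// vabs_nat.
elim: k m => [|k IH] m mk; first by rewrite dvd1n.
have mk' : vabs (m%:R : K) <= r ^+ k.
  by rewrite (le_trans mk)// exprS ler_piMl.
have /dvdnP[c cE] := IH _ mk'; rewrite cE expnS dvdn_pmul2r ?expn_gt0 ?p_gt0//.
move: mk; rewrite cE natrM natrX vabsM vabsX exprS ler_pM2r//.
by apply: contraLR => pc; rewrite -ltNge (@vabs_coprime c) ?prime_coprime.
Qed.

Lemma dvdn_vdist k m n : (n <= m)%N ->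
  (p ^ k %| m - n)%N = (vabs (m%:R - n%:R : K) <= r ^+ k).
Proof. by move=> nm; rewrite -natrB// dvdn_vabs. Qed.

Lemma eqmod_vdist k m n :
  (m == n %[mod p ^ k])%N = (vabs (m%:R - n%:R : K) <= r ^+ k).
Proof.
by have [nm|/ltnW mn] := leqP n m; [|rewrite eq_sym vdistC]; rewrite eqn_mod_dvd// dvdn_vdist.
Qed.

Lemma natK_neq0 m : (0 < m)%N -> m%:R != 0 :> K.
Proof.
move=> m0; apply/eqP => mE; have : (p ^ m %| m)%N by rewrite dvdn_vabs mE vabs0.
by move=> /(dvdn_leq m0); rewrite leqNgt ltn_expl// prime_gt1.
Qed.

Lemma zp_nat m : zp m%:R.
Proof. by move=> k; exists m; rewrite subrr vabs0. Qed.

Lemma zp_le1 x : zp x -> vabs x <= 1.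
Proof. by move=> /(_ 0)[m h]; apply: (vabs_le_dist h); rewrite vabs_nat. Qed.

Lemma zp_closed x : (forall e : R, 0 < e -> exists2 y, zp y & vabs (x - y) <= e) ->
  zp x.
Proof.
move=> h k; have [y /(_ k)[m ym] xy] := h _ (rX_gt0 k).
by exists m; apply: vdist_trans ym.
Qed.

Lemma zp_div k n x : zp x -> vabs (x - n%:R) <= r ^+ k ->
  zp ((x - n%:R) / p%:R ^+ k).
Proof.
move=> xz xn j; have [m xm] := xz (k + j)%N.
(* a natural number close to x which is at least n *)
pose m' := (m + n * p ^ (k + j))%N.
have xm' : vabs (x - m'%:R) <= r ^+ (k + j).
  rewrite natrD opprD addrA vabsB_le// -(dvdn_vabs (k + j)).
  by rewrite dvdn_mull.
have nm' : (n <= m')%N by rewrite (leq_trans _ (leq_addl _ _))// leq_pmulr// expn_gt0 p_gt0.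
have : (p ^ k %| m' - n)%N.
  rewrite dvdn_vdist//; apply: vdist_trans xn; rewrite vdistC (le_trans xm')//.
  by rewrite exprn_ile1_le// leq_addr.
move=> /dvdnP[c cE]; exists c.
have p0 : p%:R ^+ k != 0 :> K by rewrite expf_neq0.
rewrite -[c%:R](mulfK p0) -natrX -natrM -cE natrB// natrX -mulrBl opprB addrA subrK.
by rewrite vabsM vabsV vabsX ler_pdivrMr// -exprD addnC.
Qed.

Lemma zp_unit_or_small x : zp x -> vabs x = 1 \/ vabs x <= r.
Proof.
move=> /(_ 1%N)[m]; rewrite expr1 => xm.
have [pm|pm] := boolP (p %| m)%N.
  right; apply: (vabs_le_dist xm); have := dvdn_vabs 1 m.
  by rewrite expn1 expr1 pm => <-.
left; rewrite -(vabs_coprime (m := m)) ?prime_coprime//.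
by apply: vabs_dominant; rewrite vabs_coprime ?prime_coprime// (le_lt_trans xm).
Qed.

(** The indicator function of the units is the limit of the powers with
    exponent phi(p ^ k), by the theorem of Euler. *)
Lemma zp_euler k x : zp x -> vabs x = 1 ->
  vabs (x ^+ totient (p ^ k) - 1) <= r ^+ k.
Proof.
move=> xz x1; have [k0|k0] := posnP k.
  by rewrite k0 expr0 vabsB_le ?vabs1// vabsX x1 expr1n.
have [m xm] := xz k.
have pm : coprime m (p ^ k).
  rewrite coprime_pexpr// coprime_sym prime_coprime//; apply/negP => pm.
  have : vabs (m%:R : K) <= r by have := dvdn_vabs 1 m; rewrite expn1 expr1 pm => <-.
  rewrite (@vabs_dominant _ _ _ x) ?x1 1?leNgt ?p_lt1//.
  by rewrite vdistC (le_lt_trans xm)// exprn_ilt1// -lt0n.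
apply: (@vdist_trans _ _ (m ^ totient (p ^ k))%:R); last first.
  by rewrite -(eqmod_vdist k _ 1) Euler_exp_totient.
by rewrite natrX (le_trans (vabs_subrXX _ _ _))// ?x1// vabs_nat.
Qed.

Lemma zp_small_totient k x : vabs x <= r -> vabs (x ^+ totient (p ^ k)) <= r ^+ k.
Proof.
move=> xr; rewrite vabsX (le_trans (lerXn2r _ _ _ xr)) ?nnegrE ?vabs_ge0//.
apply: exprn_ile1_le => //; case: k => // k.
rewrite totient_pfactor// (leq_trans (ltn_expl k (prime_gt1 p_prime)))//.
by rewrite leq_pmull// -subn1 subn_gt0 prime_gt1.
Qed.

End PadicIntegers.
(** * The powers of 1 + p *)

Section PrincipalUnits.
Variables (R : realType) (K : completeValuedFieldType R) (p : nat).
Hypotheses (p_prime : prime p) (p_lt1 : vabs (p%:R : K) < 1)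
           (p_neq0 : p%:R != 0 :> K).
Local Notation r := (vabs (p%:R : K)).
Local Notation zp := (@zp R K p).
Implicit Types (x y z l s : K) (k m n : nat).

Let r_gt0 : 0 < r. Proof. by rewrite vabs_gt0. Qed.
Let r_ge0 : 0 <= r. Proof. exact: ltW. Qed.
Let r_le1 : r <= 1. Proof. exact: ltW. Qed.
Let rX_gt0 k : 0 < r ^+ k. Proof. exact: exprn_gt0. Qed.
Let rX_ge0 k : 0 <= r ^+ k. Proof. exact: ltW. Qed.
Let le_rX m n : (m <= n)%N -> r ^+ n <= r ^+ m.
Proof. exact: exprn_ile1_le. Qed.

Lemma vabs_natM_le n x c : vabs x <= c -> vabs (n%:R * x) <= c.
Proof.
by move=> xc; rewrite vabsM (le_trans _ xc)// ler_piMl ?vabs_ge0// vabs_nat.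
Qed.

Lemma expr1D_order2 x m : vabs x <= 1 ->
  vabs ((1 + x) ^+ m - (1 + m%:R * x)) <= vabs x ^+ 2.
Proof.
move=> x1; elim: m => [|m IH]; first by rewrite mul0r addr0 subrr vabs0 exprn_ge0 ?vabs_ge0.
have -> : (1 + x) ^+ m.+1 - (1 + m.+1%:R * x) =
    ((1 + x) ^+ m - (1 + m%:R * x)) * (1 + x) + m%:R * x ^+ 2.
  by rewrite exprSr -natr1; ring.
rewrite vabsD_le//; last by apply: vabs_natM_le; rewrite vabsX.
by rewrite vabsM (le_trans _ IH)// ler_piMr ?vabs_ge0// vabsD_le ?vabs1.
Qed.

Lemma expr1D_order3 x m : vabs x <= 1 ->
  vabs ((1 + x) ^+ m - (1 + m%:R * x + 'C(m, 2)%:R * x ^+ 2)) <= vabs x ^+ 3.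
Proof.
move=> x1; elim: m => [|m IH].
  by rewrite !mul0r !addr0 subrr vabs0 exprn_ge0 ?vabs_ge0.
have -> : (1 + x) ^+ m.+1 - (1 + m.+1%:R * x + 'C(m.+1, 2)%:R * x ^+ 2) =
    ((1 + x) ^+ m - (1 + m%:R * x + 'C(m, 2)%:R * x ^+ 2)) * (1 + x)
    + 'C(m, 2)%:R * x ^+ 3.
  by rewrite exprSr -natr1 binS bin1 natrD; ring.
rewrite vabsD_le//; last by apply: vabs_natM_le; rewrite vabsX.
by rewrite vabsM (le_trans _ IH)// ler_piMr ?vabs_ge0// vabsD_le ?vabs1.
Qed.

Hypothesis p_odd : p <> 2%N.

(** This is where p has to be odd: for p = 2 the binomial coefficient of the
    quadratic term is not divisible by p, and indeed 3 ^ 2 = 1 + 8. *)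
Lemma expr1p_order k :
  vabs ((1 + p%:R) ^+ (p ^ k) - (1 + p%:R ^+ k.+1) : K) <= r ^+ k.+2.
Proof.
elim: k => [|k IH]; first by rewrite !expr1 subrr vabs0.
rewrite expnSr exprM; set y := _ ^+ (p ^ k) in IH *; pose a := y - 1.
have ya : y = 1 + a by rewrite addrC subrK.
have aE : vabs (a - p%:R ^+ k.+1) <= r ^+ k.+2 by move: IH; rewrite opprD addrA.
have ar : vabs a <= r ^+ k.+1.
  by apply: (vabs_le_dist (le_trans aE _)); rewrite ?vabsX ?le_rX.
have a1 : vabs a <= 1 by rewrite (le_trans ar)// exprn_ile1.
rewrite ya; apply: vdist_trans (le_trans (expr1D_order3 p a1) _) _.
  by rewrite (le_trans (lerXn2r 3 _ _ ar)) ?nnegrE ?vabs_ge0// -exprM le_rX; lia.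
have -> : 1 + p%:R * a + 'C(p, 2)%:R * a ^+ 2 - (1 + p%:R ^+ k.+2) =
    p%:R * (a - p%:R ^+ k.+1) + 'C(p, 2)%:R * a ^+ 2.
  by rewrite [p%:R ^+ k.+2]exprS; ring.
rewrite vabsD_le//; first by rewrite vabsM [r ^+ k.+3]exprS ler_wpM2l.
have : vabs ('C(p, 2)%:R : K) <= r ^+ 1.
  rewrite -dvdn_vabs// expn1 prime_dvd_bin//= ltn_neqAle (prime_gt1 p_prime) andbT.
  by apply/eqP => /esym.
rewrite vabsM vabsX => Cr.
have a2 : vabs a ^+ 2 <= r ^+ (k.+1 * 2).
  by rewrite exprM; apply: lerXn2r; rewrite ?nnegrE ?vabs_ge0.
rewrite (le_trans (ler_pM _ _ Cr a2)) ?exprn_ge0 ?vabs_ge0// -exprD le_rX; lia.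
Qed.

Lemma expr1p_mul_order k m :
  vabs ((1 + p%:R) ^+ (m * p ^ k) - (1 + m%:R * p%:R ^+ k.+1) : K) <= r ^+ k.+2.
Proof.
have := expr1p_order k; rewrite mulnC exprM; set y := _ ^+ (p ^ k); pose a := y - 1.
have ya : y = 1 + a by rewrite addrC subrK.
move=> IH; have aE : vabs (a - p%:R ^+ k.+1) <= r ^+ k.+2 by move: IH; rewrite opprD addrA.
have ar : vabs a <= r ^+ k.+1.
  by apply: (vabs_le_dist (le_trans aE _)); rewrite ?vabsX ?le_rX.
have a1 : vabs a <= 1 by rewrite (le_trans ar)// exprn_ile1.
rewrite ya; apply: vdist_trans (le_trans (expr1D_order2 m a1) _) _.
  by rewrite (le_trans (lerXn2r 2 _ _ ar)) ?nnegrE ?vabs_ge0// -exprM le_rX; lia.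
by rewrite opprD addrACA subrr add0r -mulrBr vabs_natM_le.
Qed.

Lemma vabs_1p : vabs (1 + p%:R : K) = 1.
Proof. by rewrite -[RHS](vabs1 K); apply: vabs_dominant; rewrite addrAC subrr add0r vabs1. Qed.

Lemma vabs_1pX_sub1 m : vabs ((1 + p%:R) ^+ m - 1 : K) <= r.
Proof.
rewrite -[X in _ - X](expr1n K m) (le_trans (vabs_subrXX _ _ _)) ?vabs_1p ?vabs1//.
by rewrite addrAC subrr add0r.
Qed.

(** The number 1 + p generates the group of principal units topologically. *)
Lemma expr1p_dense s k : zp s -> vabs (s - 1) <= r ->
  exists m, vabs ((1 + p%:R) ^+ m - s) <= r ^+ k.+1.
Proof.
move=> sz s1; elim: k => [|k [m mk]]; first by exists 0%N; rewrite vdistC.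
have sm : vabs (s - ((1 + p) ^ m)%:R) <= r ^+ k.+1 by rewrite vdistC natrX natrD.
have [j] := zp_div p_prime p_lt1 p_neq0 sz sm 1; rewrite natrX natrD expr1 => jr.
exists (m + j * p ^ k)%N.
have -> : (1 + p%:R) ^+ (m + j * p ^ k) - s =
    (1 + p%:R) ^+ m * ((1 + p%:R) ^+ (j * p ^ k) - (1 + j%:R * p%:R ^+ k.+1))
    + (((1 + p%:R) ^+ m - 1) * (j%:R * p%:R ^+ k.+1)
       - p%:R ^+ k.+1 * ((s - (1 + p%:R) ^+ m) / p%:R ^+ k.+1 - j%:R)).
  by rewrite exprD; field; rewrite expf_neq0.
rewrite vabsD_le//.
  by rewrite vabsM vabsX vabs_1p expr1n mul1r expr1p_mul_order.
rewrite vabsB_le//; last by rewrite vabsM vabsX mulrC [r ^+ k.+2]exprS ler_wpM2r.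
rewrite vabsM [r ^+ k.+2]exprS ler_pM ?vabs_ge0 ?vabs_1pX_sub1//.
by rewrite vabs_natM_le// vabsX.
Qed.

(** If d = c * p ^ k then (1 + p) ^ d - 1 is c * p ^ k.+1 up to terms of higher
    order; it can only be smaller than p ^ k.+1 when p divides c. *)
Lemma expr1p_sub1_dvd k d : vabs ((1 + p%:R) ^+ d - 1 : K) <= r ^+ k.+1 -> (p ^ k %| d)%N.
Proof.
elim: k => [|k IH] dk; first by rewrite dvd1n.
have /dvdnP[c cE] := IH (le_trans dk (le_rX (leqnSn _))).
rewrite cE expnS dvdn_pmul2r ?expn_gt0 ?prime_gt0//.
have : vabs (c%:R * p%:R ^+ k.+1 : K) <= r ^+ k.+2.
  have -> : c%:R * p%:R ^+ k.+1 = (1 + p%:R) ^+ d - 1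
      - ((1 + p%:R) ^+ (c * p ^ k) - (1 + c%:R * p%:R ^+ k.+1)) :> K.
    by rewrite cE; ring.
  exact: vabsB_le dk (expr1p_mul_order k c).
rewrite vabsM vabsX [r ^+ k.+2]exprS ler_pM2r// => cr.
by rewrite -[X in (X %| _)%N]expn1 (dvdn_vabs p_prime p_lt1 p_neq0).
Qed.

Lemma expr1p_inj k m n :
  vabs ((1 + p%:R) ^+ m - (1 + p%:R) ^+ n : K) <= r ^+ k.+1 ->
  vabs (m%:R - n%:R : K) <= r ^+ k.
Proof.
wlog nm : m n / (n <= m)%N.
  move=> wl h; have [/wl|/ltnW mn] := leqP n m; first exact.
  by rewrite vdistC; apply: wl => //; rewrite vdistC.
rewrite -(subnK nm) exprD -[X in _ - X]mul1r -mulrBl vabsM vabsX vabs_1p expr1n mulr1.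
by move/expr1p_sub1_dvd; rewrite natrD addrK (dvdn_vabs p_prime p_lt1 p_neq0).
Qed.

End PrincipalUnits.
(** * Powers with p-adic integer exponents *)

Section PadicPowers.
Variables (R : realType) (K : completeValuedFieldType R) (p : nat).
Hypotheses (p_prime : prime p) (p_lt1 : vabs (p%:R : K) < 1)
           (p_neq0 : p%:R != 0 :> K).
Local Notation r := (vabs (p%:R : K)).
Local Notation zp := (@zp R K p).
Implicit Types (x y z l s : K) (k m n N : nat).

Let r_gt0 : 0 < r. Proof. by rewrite vabs_gt0. Qed.
Let r_ge0 : 0 <= r. Proof. exact: ltW. Qed.
Let r_le1 : r <= 1. Proof. exact: ltW. Qed.
Let rX_gt0 k : 0 < r ^+ k. Proof. exact: exprn_gt0. Qed.
Let rX_ge0 k : 0 <= r ^+ k. Proof. exact: ltW. Qed.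
Let le_rX m n : (m <= n)%N -> r ^+ n <= r ^+ m.
Proof. exact: exprn_ile1_le. Qed.

Lemma fact_neq0 n : n`!%:R != 0 :> K.
Proof. by rewrite (natK_neq0 p_prime)// fact_gt0. Qed.

Lemma binom_poly_nat n m : binom_poly n (m%:R : K) = 'C(m, n)%:R.
Proof.
apply: (mulIf (fact_neq0 n)); rewrite /binom_poly divfK ?fact_neq0// -natrM bin_ffact.
elim: n => [|n IH]; first by rewrite big_ord0.
rewrite big_ord_recr/= IH ffactnSr natrM; have [nm|mn] := leqP n m; first by rewrite natrB.
by rewrite ffact_small// !mul0r.
Qed.

Lemma prod_sub_lipschitz n x y : vabs x <= 1 -> vabs y <= 1 ->
  vabs (\prod_(i < n) (x - i%:R)) <= 1 /\
  vabs (\prod_(i < n) (x - i%:R) - \prod_(i < n) (y - i%:R)) <= vabs (x - y).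
Proof.
move=> x1 y1; elim: n => [|n [IH1 IH2]].
  by rewrite !big_ord0 subrr vabs0 vabs1; split; rewrite ?vabs_ge0.
rewrite !big_ord_recr/=; set a := \prod_(i < n) _ in IH1 IH2 *.
set b := \prod_(i < n) _ in IH2 *.
have xn t : vabs t <= 1 -> vabs (t - n%:R : K) <= 1 by move=> t1; rewrite vabsB_le// vabs_nat.
split; first by rewrite vabsM mulr_ile1 ?vabs_ge0// xn.
have -> : a * (x - n%:R) - b * (y - n%:R) = a * (x - y) + (a - b) * (y - n%:R) by ring.
rewrite vabsD_le// vabsM; first by rewrite ler_piMl ?vabs_ge0.
by rewrite (le_trans _ IH2)// ler_piMr ?vabs_ge0// xn.
Qed.

Lemma binom_poly_lipschitz n x y : vabs x <= 1 -> vabs y <= 1 ->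
  vabs (binom_poly n x - binom_poly n y) <= vabs (x - y) / vabs (n`!%:R : K).
Proof.
move=> x1 y1; rewrite /binom_poly -mulrBl vabsM vabsV ler_wpM2r ?invr_ge0 ?vabs_ge0//.
by have [] := prod_sub_lipschitz n x1 y1.
Qed.

(** Binomial coefficients of natural numbers are integers, and the binomial
    polynomials are continuous. *)
Lemma binom_poly_le1 n l : zp l -> vabs (binom_poly n l) <= 1.
Proof.
move=> lz; have l1 := zp_le1 lz.
have nf : 0 < vabs (n`!%:R : K) by rewrite vabs_gt0 fact_neq0.
have [k kn] := r_small p_lt1 p_neq0 nf.
have [m lm] := lz k; apply: (@vabs_le_dist _ _ _ _ (binom_poly n m%:R)).
  rewrite (le_trans (binom_poly_lipschitz _ _ _)) ?vabs_nat//.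
  by rewrite ler_pdivrMr // mul1r ltW// (le_lt_trans lm).
by rewrite binom_poly_nat vabs_nat.
Qed.

Definition vpow_part s l N : K := \sum_(0 <= i < N) (s - 1) ^+ i * binom_poly i l.

Lemma vpow_term_le s l i : vabs (s - 1) <= r -> zp l ->
  vabs ((s - 1) ^+ i * binom_poly i l) <= r ^+ i.
Proof.
move=> sr lz; rewrite vabsM vabsX -[leRHS]mulr1 ler_pM ?exprn_ge0 ?vabs_ge0 ?binom_poly_le1//.
by apply: lerXn2r; rewrite ?nnegrE ?vabs_ge0.
Qed.

Lemma vpow_part_cauchy s l M N : vabs (s - 1) <= r -> zp l -> (N <= M)%N ->
  vabs (vpow_part s l M - vpow_part s l N) <= r ^+ N.
Proof.
move=> sr lz NM; rewrite /vpow_part (big_cat_nat (n := N))//= addrAC subrr add0r.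
rewrite big_seq_cond; apply: vabs_sum => // i; rewrite mem_index_iota andbT => /andP[Ni _].
by rewrite (le_trans (vpow_term_le _ _ _))// le_rX.
Qed.

Lemma vpow_tail s l N : vabs (s - 1) <= r -> zp l ->
  vabs (vpow s l - vpow_part s l N) <= r ^+ N.
Proof.
move=> sr lz.
have [|t tl] := @vabs_complete R K (vpow_part s l).
  move=> e /(expr_small r_ge0 p_lt1)[k ke]; exists k => m n km kn.
  apply: le_lt_trans (ke k (leqnn k)).
  by apply: (@vdist_trans _ _ (vpow_part s l k)); [|rewrite vdistC]; rewrite vpow_part_cauchy.
have : vpow_part s l @ \oo --> vpow s l.
  apply: (@xgetPex _ 0 [set u | vpow_part s l @ \oo --> u]); exists t.
  apply/vcvgP => e /tl[k ke]; exists k => // n kn.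
  by rewrite /= vdistC; exact: ke.
move=> /vcvgP /(_ _ (rX_gt0 N)) [M _ Mh].
apply: (@vdist_trans _ _ (vpow_part s l (maxn M N))).
  by apply/ltW/Mh; rewrite /= leq_maxl.
by rewrite vpow_part_cauchy// leq_maxr.
Qed.

Lemma vpow_part_nat s m j : vpow_part s m%:R (m.+1 + j) = s ^+ m.
Proof.
rewrite /vpow_part; elim: j => [|j IH]; last first.
  by rewrite addnS big_nat_recr//= IH binom_poly_nat bin_small ?mulr0 ?addr0// leq_addr.
rewrite addn0 -[in RHS](subrK 1 s) [in RHS]addrC exprDn big_mkord.
by apply: eq_bigr => i _; rewrite binom_poly_nat expr1n mul1r mulr_natr.
Qed.

Lemma vpow_nat s m : vabs (s - 1) <= r -> vpow s m%:R = s ^+ m.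
Proof.
move=> sr; apply/eqP; rewrite -subr_eq0; apply/eqP/vabs_small_eq0 => e e0.
have [k ke] := expr_small r_ge0 p_lt1 e0.
rewrite -(vpow_part_nat s m k) (le_trans (vpow_tail _ _ _))//; first exact: zp_nat.
by rewrite ltW// ke// leq_addl.
Qed.

Lemma vpow_uniformly_continuous s e : vabs (s - 1) <= r -> 0 < e ->
  exists2 d : R, 0 < d & forall l l', zp l -> zp l' -> vabs (l - l') <= d ->
    vabs (vpow s l - vpow s l') <= e.
Proof.
move=> sr e0; have [N /(_ N (leqnn N)) Ne] := expr_small r_ge0 p_lt1 e0.
exists (e * vabs (N`!%:R : K)); first by rewrite mulr_gt0// vabs_gt0 fact_neq0.
move=> l l' lz l'z ll'.
apply: (vdist_trans (le_trans (vpow_tail N sr lz) (ltW Ne))); rewrite vdistC.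
apply: (vdist_trans (le_trans (vpow_tail N sr l'z) (ltW Ne))).
rewrite /vpow_part -sumrB big_seq_cond; apply: vabs_sum; first exact: ltW.
move=> i; rewrite mem_index_iota andbT => iN.
rewrite -mulrBr vabsM (le_trans (_ : _ <= 1 * vabs (binom_poly i l' - binom_poly i l)))//.
  by rewrite ler_wpM2r ?vabs_ge0// vabsX exprn_ile1 ?vabs_ge0// (le_trans sr).
rewrite mul1r vdistC (le_trans (binom_poly_lipschitz _ (zp_le1 lz) (zp_le1 l'z)))//.
rewrite ler_pdivrMr ?vabs_gt0 ?fact_neq0// (le_trans ll')// ler_pM2l//.
by rewrite (fact_split (ltnW iN)) natrM vabsM ler_piMr ?vabs_ge0 ?vabs_nat.
Qed.

(** With zp_approx, this reduces statements about powers to natural exponents. *)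
Lemma vpow_approx s l e : vabs (s - 1) <= r -> zp l -> 0 < e ->
  exists2 d : R, 0 < d & forall m : nat, vabs (l - m%:R) <= d ->
    vabs (vpow s l - s ^+ m) <= e.
Proof.
move=> sr lz e0; have [d d0 dh] := vpow_uniformly_continuous sr e0.
by exists d => // m lm; rewrite -(vpow_nat m sr) dh//; exact: zp_nat.
Qed.

Lemma zp_approx l d : zp l -> 0 < d -> exists m : nat, vabs (l - m%:R) <= d.
Proof.
move=> lz /(r_small p_lt1 p_neq0)[k kd]; have [m lm] := lz k; exists m.
by rewrite (le_trans lm)// ltW.
Qed.

Lemma vpow_le1 s l : vabs (s - 1) <= r -> zp l -> vabs (vpow s l) <= 1.
Proof.
move=> sr lz; rewrite (vabs_le_dist (vpow_tail 0 sr lz))//.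
by rewrite /vpow_part big_geq// vabs0.
Qed.

Lemma vabs_expr_sub1 s n : vabs (s - 1) <= r -> vabs (s ^+ n - 1) <= r.
Proof.
move=> sr; have s1 : vabs s <= 1 by apply: (vabs_le_dist (le_trans sr r_le1)); rewrite vabs1.
by rewrite -[X in _ - X](expr1n K n) (le_trans (vabs_subrXX _ s1 _)) ?vabs1.
Qed.

(** Both sides are continuous in the exponent, and agree at the natural
    numbers. The same density argument gives the two lemmas that follow. *)
Lemma vpow_expr s n l : vabs (s - 1) <= r -> zp l ->
  vpow (s ^+ n) l = vpow s l ^+ n.
Proof.
move=> sr lz; apply/eqP; rewrite -subr_eq0; apply/eqP/vabs_small_eq0 => e e0.
have [d1 d10 h1] := vpow_approx sr lz e0.
have [d2 d20 h2] := vpow_approx (vabs_expr_sub1 n sr) lz e0.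
have [m] : exists m : nat, vabs (l - m%:R) <= Num.min d1 d2.
  by apply: zp_approx => //; rewrite lt_min d10.
rewrite le_min => /andP[/h1 lm1 /h2 lm2]; apply: (vdist_trans lm2).
rewrite -exprM mulnC exprM vdistC (le_trans (vabs_subrXX _ _ _)) ?vpow_le1//.
by rewrite vabsX exprn_ile1 ?vabs_ge0// (vabs_le_dist (le_trans sr r_le1))// vabs1.
Qed.

Lemma vpow_base_lipschitz s t l : vabs (s - 1) <= r -> vabs (t - 1) <= r -> zp l ->
  vabs (vpow s l - vpow t l) <= vabs (s - t).
Proof.
move=> sr tr lz; have [->|st] := eqVneq s t; first by rewrite !subrr.
have e0 : 0 < vabs (s - t) by rewrite vabs_gt0 subr_eq0.
have [d1 d10 h1] := vpow_approx sr lz e0.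
have [d2 d20 h2] := vpow_approx tr lz e0.
have [m] : exists m : nat, vabs (l - m%:R) <= Num.min d1 d2.
  by apply: zp_approx => //; rewrite lt_min d10.
rewrite le_min => /andP[/h1 lm1 /h2 lm2]; apply: (vdist_trans lm1).
rewrite vdistC; apply: (vdist_trans lm2); rewrite vdistC vabs_subrXX//.
  by rewrite (vabs_le_dist (le_trans sr r_le1))// vabs1.
by rewrite (vabs_le_dist (le_trans tr r_le1))// vabs1.
Qed.

Hypothesis p_odd : p <> 2%N.

Let vabs_1p_sub1 : vabs (1 + p%:R - 1 : K) <= r.
Proof. by rewrite addrAC subrr add0r. Qed.

Lemma vpow_1p_inj k l l' : zp l -> zp l' ->
  vabs (vpow (1 + p%:R) l - vpow (1 + p%:R) l') <= r ^+ k.+1 ->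
  vabs (l - l') <= r ^+ k.
Proof.
move=> lz l'z ll'.
have [d d0 h] := vpow_approx vabs_1p_sub1 lz (rX_gt0 k.+1).
have [d' d'0 h'] := vpow_approx vabs_1p_sub1 l'z (rX_gt0 k.+1).
have [m] : exists m : nat, vabs (l - m%:R) <= Num.min d (r ^+ k).
  by apply: zp_approx => //; rewrite lt_min d0 rX_gt0.
rewrite le_min => /andP[/h lm lmk].
have [n] : exists n : nat, vabs (l' - n%:R) <= Num.min d' (r ^+ k).
  by apply: zp_approx => //; rewrite lt_min d'0 rX_gt0.
rewrite le_min => /andP[/h' ln lnk].
apply: (vdist_trans lmk); rewrite vdistC; apply: (vdist_trans lnk); rewrite vdistC.
apply: expr1p_inj => //; rewrite vdistC in lm.
by apply: (vdist_trans lm); exact: (vdist_trans ll').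
Qed.

(** Natural exponents whose powers of 1 + p converge to s form a Cauchy
    sequence, by expr1p_inj. *)
Lemma vpow_1p_surj s : zp s -> vabs (s - 1) <= r ->
  exists2 l, zp l & vpow (1 + p%:R) l = s.
Proof.
move=> sz sr; have [m mh] := choice (fun k => expr1p_dense p_prime p_lt1 p_neq0 p_odd k sz sr).
have mk j k : (k <= j)%N -> vabs ((m j)%:R - (m k)%:R : K) <= r ^+ k.
  move=> kj; apply: (expr1p_inj p_prime) => //.
  by apply: (@vdist_trans _ _ s); [|rewrite vdistC]; rewrite (le_trans (mh _))// le_rX.
have [|l lm] := @vabs_complete R K (fun k => (m k)%:R).
  move=> e /(r_small p_lt1 p_neq0)[k ke]; exists k => i j ki kj.
  apply: le_lt_trans ke.
  by apply: (@vdist_trans _ _ (m k)%:R); [|rewrite vdistC]; rewrite mk.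
have lmk k : vabs (l - (m k)%:R) <= r ^+ k.
  have [N /(_ (maxn N k) (leq_maxl _ _)) h] := lm _ (rX_gt0 k).
  apply: (@vdist_trans _ _ (m (maxn N k))%:R); first by rewrite vdistC ltW.
  by rewrite mk// leq_maxr.
have lz : zp l by move=> k; exists (m k).
exists l => //; apply/eqP; rewrite -subr_eq0; apply/eqP/vabs_small_eq0 => e e0.
have [d d0 h] := vpow_approx vabs_1p_sub1 lz e0.
have [k ke] : exists k, r ^+ k < Num.min d e.
  by apply: (r_small p_lt1 p_neq0); rewrite lt_min d0.
move: ke; rewrite lt_min => /andP[/ltW kd /ltW ke].
apply: (vdist_trans (h (m k) (le_trans (lmk k) kd))).
by rewrite (le_trans (mh k))// (le_trans _ ke)// le_rX.
Qed.

End PadicPowers.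
(** * The field of p-adic numbers *)

Section PadicField.
Variables (R : realType) (p : nat) (Qp : completeValuedFieldType R).
Hypotheses (p_prime : prime p) (Qp_padic : is_padic_field p Qp).
Local Notation r := (vabs (p%:R : Qp)).

Lemma padic_p_lt1 : vabs (p%:R : Qp) < 1.
Proof.
have [h _] := Qp_padic; rewrite -ratr_nat h /padic_abs pnatr_eq0 eqn0Ngt prime_gt0//=.
have -> : (p%:R : rat) = p%:Z%:~R by [].
rewrite numq_int denq_int/= logn1 logn_prime// eqxx.
by rewrite invf_lt1 ?ltr1n ?ltr0n ?prime_gt1 ?prime_gt0.
Qed.

Lemma padic_p_neq0 : p%:R != 0 :> Qp.
Proof.
have [h _] := Qp_padic; rewrite -vabs_eq0 -ratr_nat h /padic_abs pnatr_eq0 eqn0Ngt prime_gt0//=.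
by rewrite expfz_eq0 pnatr_eq0 eqn0Ngt prime_gt0// andbF.
Qed.

Let p_lt1 := padic_p_lt1.
Let p_neq0 := padic_p_neq0.

Lemma vabs_int (a : int) : vabs (a%:~R : Qp) = vabs (`|a|%N%:R : Qp).
Proof. by case: a => n //; rewrite NegzE rmorphN/= vabsN. Qed.

(** A p-integral fraction has a denominator prime to p, which is invertible
    modulo each power of p. *)
Lemma rat_zp (q : rat) : vabs (ratr q : Qp) <= 1 -> zp p (ratr q : Qp).
Proof.
move=> q1 k; have b0 : (0 < `|denq q|)%N by rewrite absz_gt0 denq_eq0.
have bE : (denq q)%:~R = `|denq q|%N%:R :> Qp.
  by rewrite -{1}[denq q]gtz0_abs// ?denq_gt0.
have bn0 : `|denq q|%N%:R != 0 :> Qp by rewrite (natK_neq0 p_prime).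
have pb : coprime p `|denq q|.
  rewrite prime_coprime//; apply/negP => pb.
  have pa : coprime p `|numq q| by rewrite coprime_sym (coprime_dvdr pb)// coprime_num_den.
  move: q1; rewrite /ratr bE vabsM vabsV vabs_int (vabs_coprime p_prime p_lt1 p_neq0 pa) mul1r.
  rewrite invf_le1 ?vabs_gt0// leNgt (le_lt_trans _ p_lt1)//.
  by have := dvdn_vabs p_prime p_lt1 p_neq0 1 `|denq q|; rewrite expn1 expr1 pb => <-.
have [a aE] : exists a : nat, vabs ((numq q)%:~R - a%:R : Qp) <= r ^+ k.
  case: (numq q) => n; first by exists n; rewrite subrr vabs0 exprn_ge0 ?vabs_ge0.
  exists (n.+1 * (p ^ k).-1)%N.
  have -> : (Negz n)%:~R - (n.+1 * (p ^ k).-1)%:R = - (n.+1 * p ^ k)%:R :> Qp.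
    by rewrite -[in RHS](@prednK (p ^ k)) ?expn_gt0 ?prime_gt0// mulnS natrD NegzE rmorphN/= opprD.
  by rewrite vabsN -(dvdn_vabs p_prime p_lt1 p_neq0) dvdn_mull.
case: (egcdnP (p ^ k) b0) => u v uv _.
have {}uv : (u * `|denq q| = v * p ^ k + 1)%N.
  by rewrite uv; congr addn; apply/eqP; rewrite -/(coprime _ _) coprime_sym coprimeXl.
exists (u * a)%N.
have -> : ratr q - (u * a)%:R = ((numq q)%:~R - a%:R - (v * p ^ k * a)%:R) / `|denq q|%N%:R :> Qp.
  rewrite /ratr bE mulrBl; apply: (mulIf bn0); rewrite !mulrBl !divfK//.
  rewrite -!natrM -addrA -opprD -natrD; congr (_ - _%:R).
  by rewrite mulnAC uv mulnDl mul1n addnC.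
rewrite vabsM vabsV (vabs_coprime p_prime p_lt1 p_neq0 pb) invr1 mulr1 vabsB_le//.
by rewrite -(dvdn_vabs p_prime p_lt1 p_neq0) mulnAC dvdn_mull.
Qed.

Lemma padic_int_zp (x : Qp) : padic_int x -> zp p x.
Proof.
rewrite /padic_int/= => x1; have [_ dQ] := Qp_padic; apply: zp_closed => // e e0.
have e10 : 0 < Num.min e 1 by rewrite lt_min e0 ltr01.
have [||y [/= xy [q _ qy]]] := dQ [set y | vabs (x - y) < Num.min e 1].
- by exists x; rewrite /= subrr vabs0.
- rewrite openE => y /= xy; apply/vnbhsP; exists (Num.min e 1) => // z yz.
  exact: vdist_lt_trans yz.
move: xy; rewrite -qy lt_min => /andP[/ltW xe /ltW x1'].
exists (ratr q) => //; apply: rat_zp; rewrite vdistC in x1'.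
exact: vabs_le_dist x1' x1.
Qed.

Lemma padic_lt1_le (x : Qp) : vabs x < 1 -> vabs x <= r.
Proof.
move=> x1; have [xE|//] := zp_unit_or_small p_prime p_lt1 p_neq0 (padic_int_zp (ltW x1) : zp p x).
by rewrite xE ltxx in x1.
Qed.

Variables (K : completeValuedFieldType R) (iota : {rmorphism Qp -> K}).
Hypothesis iota_isom : forall x : Qp, vabs (iota x) = vabs x.

Lemma vabs_natK m : vabs (m%:R : K) = vabs (m%:R : Qp).
Proof. by rewrite -iota_isom rmorph_nat. Qed.

Lemma padic_p_lt1K : vabs (p%:R : K) < 1. Proof. by rewrite vabs_natK. Qed.

Lemma padic_p_neq0K : p%:R != 0 :> K.
Proof. by rewrite -vabs_eq0 vabs_natK vabs_eq0. Qed.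

Lemma iota_zp x : padic_int x -> zp p (iota x).
Proof.
move=> /padic_int_zp xz k; have [m xm] := xz k; exists m.
by rewrite -(rmorph_nat iota m) -rmorphB iota_isom vabs_natK.
Qed.

Lemma zp_iota (y : K) : zp p y -> exists2 x, @padic_int R Qp x & iota x = y.
Proof.
move=> yz; have [m ym] := choice yz.
have mk j k : (k <= j)%N -> vabs ((m j)%:R - (m k)%:R : Qp) <= r ^+ k.
  move=> kj; rewrite -iota_isom rmorphB/= !rmorph_nat -vabs_natK.
  apply: (@vdist_trans _ _ y) => //; rewrite vdistC (le_trans (ym _))//.
  by rewrite exprn_ile1_le// ?vabs_ge0// ltW// padic_p_lt1K.
have [|x xm] := @vabs_complete R Qp (fun k => (m k)%:R).
  move=> e /(r_small p_lt1 p_neq0)[k ke]; exists k => i j ki kj.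
  apply: le_lt_trans ke.
  by apply: (@vdist_trans _ _ (m k)%:R); [|rewrite vdistC]; rewrite mk.
exists x.
  have [k /(_ k (leqnn k)) /ltW h] := xm 1 ltr01.
  by rewrite vdistC in h; rewrite /padic_int/= (vabs_le_dist h)// vabs_nat.
apply/eqP; rewrite -subr_eq0; apply/eqP/vabs_small_eq0 => e e0.
have [k ke] := r_small padic_p_lt1K padic_p_neq0K e0.
have [N h] := xm e e0; apply: (@vdist_trans _ _ (m (maxn N k))%:R).
  by rewrite -(rmorph_nat iota) -rmorphB iota_isom vdistC ltW// h// leq_maxl.
rewrite vdistC (le_trans (ym _))// (le_trans _ (ltW ke))//.
by rewrite exprn_ile1_le ?vabs_ge0 ?leq_maxr// ltW// padic_p_lt1K.
Qed.

End PadicField.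
(** * Multiplicative seminorms attaining a uniform norm *)

Section UniformSeminorms.
Variables (R : realType) (A : pzRingType) (D : set A).
Hypotheses (D1 : D 1) (DB : forall S T, D S -> D T -> D (S - T))
  (DM : forall S T, D S -> D T -> D (S * T))
  (DC : forall S T, D S -> D T -> S * T = T * S).
Implicit Types (S T f g : A) (x : A -> R).

Record uniform_seminorm x : Prop := {
  us_ge0 : forall T, D T -> 0 <= x T ;
  us0 : x 0 = 0 ;
  us1 : x 1 = 1 ;
  usB : forall S T, D S -> D T -> x (S - T) <= x S + x T ;
  usM : forall S T, D S -> D T -> x (S * T) <= x S * x T ;
  us_sqr : forall T, D T -> x (T ^+ 2) = x T ^+ 2
}.

Let DX T n : D T -> D (T ^+ n).
Proof. by move=> DT; elim: n => // n IH; rewrite exprS; exact: DM. Qed.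

Section Infimum.
Variables (I : Type) (i0 : I) (F : I -> A -> R).

Definition inf_seminorm T : R := inf (range (fun i => F i T)).

Hypothesis F_ge0 : forall i T, D T -> 0 <= F i T.

Lemma inf_seminorm_le i T : D T -> inf_seminorm T <= F i T.
Proof. by move=> DT; apply: ge_inf; [exists 0 => _ [j _ <-]; exact: F_ge0 | exists i]. Qed.

Lemma le_inf_seminorm c T : (forall i, c <= F i T) -> c <= inf_seminorm T.
Proof. by move=> h; apply: lb_le_inf; [exists (F i0 T), i0 | move=> _ [i _ <-]]. Qed.

Lemma le_inf_seminormM c d T : 0 <= d -> (forall i, c <= d * F i T) ->
  c <= d * inf_seminorm T.
Proof.
rewrite le_eqVlt => /predU1P[<- /(_ i0)|d0 h]; first by rewrite !mul0r.
by rewrite -ler_pdivrMl//; apply: le_inf_seminorm => i; rewrite ler_pdivrMl.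
Qed.

Hypotheses (F0 : forall i, F i 0 = 0) (F1 : forall i, F i 1 = 1)
  (FB : forall i j S T, D S -> D T -> exists k, F k (S - T) <= F i S + F j T)
  (FM : forall i j S T, D S -> D T -> exists k, F k (S * T) <= F i S * F j T)
  (F_sqr : forall i T, D T -> exists j, F j T ^+ 2 <= F i (T ^+ 2)).

(** Infima of chains of seminorms and of the sequences that define a smoothing
    are both covered: each inequality needs to hold only for some other member
    of the family. *)
Lemma inf_seminorm_uniform : uniform_seminorm inf_seminorm.
Proof.
have m0 T : D T -> 0 <= inf_seminorm T.
  by move=> DT; apply: le_inf_seminorm => i; exact: F_ge0.
have mM S T : D S -> D T -> inf_seminorm (S * T) <= inf_seminorm S * inf_seminorm T.
  move=> DS DT; apply: le_inf_seminormM; first exact: m0.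
  move=> j; rewrite mulrC; apply: le_inf_seminormM; first exact: F_ge0.
  move=> i; have [k kh] := FM i j DS DT; rewrite mulrC; apply: le_trans kh.
  by apply: inf_seminorm_le; exact: DM.
have cst T c : (forall i, F i T = c) -> inf_seminorm T = c.
  move=> h; rewrite /inf_seminorm; suff -> : range (fun i => F i T) = [set c] by rewrite inf1.
  by apply/seteqP; split => [_ [i _ <-]|_ ->]; [exact: h | exists i0].
split=> //.
- exact: cst.
- exact: cst.
- move=> S T DS DT; rewrite -lerBlDl; apply: le_inf_seminorm => j.
  rewrite lerBlDl -lerBlDr; apply: le_inf_seminorm => i; rewrite lerBlDr.
  have [k kh] := FB i j DS DT; apply: le_trans kh.
  by apply: inf_seminorm_le; exact: DB.
- move=> T DT; apply/eqP; rewrite eq_le expr2 mM//= -!expr2.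
  apply: le_inf_seminorm => i; have [j jh] := F_sqr i DT; apply: le_trans jh.
  by apply: lerXn2r; rewrite ?nnegrE ?F_ge0 ?m0// inf_seminorm_le.
Qed.

End Infimum.

(** Squares give all exponents 2 ^ k, and submultiplicativity goes down from
    2 ^ n to n. *)
Lemma uniform_seminormX x T n : uniform_seminorm x -> D T -> 0 < x T ->
  x (T ^+ n) = x T ^+ n.
Proof.
move=> ux DT xT; have Xle m : x (T ^+ m) <= x T ^+ m.
  elim: m => [|m IH]; first by rewrite us1.
  rewrite !exprS (le_trans (usM ux DT (DX m DT)))// ler_wpM2l//; exact: us_ge0.
have X2 k : x (T ^+ (2 ^ k)) = x T ^+ (2 ^ k).
  elim: k => [|k IH]; first by rewrite !expr1.
  by rewrite expnSr !exprM us_sqr ?IH//; exact: DX.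
apply/eqP; rewrite eq_le Xle/=.
have nk := ltnW (ltn_expl n (leqnn 2)).
rewrite -(ler_pM2r (exprn_gt0 (2 ^ n - n) xT)) -exprD subnKC// -X2 -(subnKC nk) exprD addKn.
apply: le_trans (usM ux (DX _ DT) (DX _ DT)) _; rewrite ler_wpM2l//.
by apply: (us_ge0 ux); exact: DX.
Qed.

(** The infimum is the limit of a decreasing sequence. The result is a uniform
    seminorm below x for which multiplication by g is multiplication by x g. *)
Definition smoothing x g : A -> R :=
  inf_seminorm (fun (n : nat) T => x (g ^+ n * T) / x g ^+ n).

Section Smoothing.
Variables (x : A -> R) (g : A).
Hypotheses (ux : uniform_seminorm x) (Dg : D g) (xg : 0 < x g).

Let F (n : nat) T := x (g ^+ n * T) / x g ^+ n.

Let xgn n : 0 < x g ^+ n. Proof. exact: exprn_gt0. Qed.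

Let F_ge0 n T : D T -> 0 <= F n T.
Proof.
by move=> DT; rewrite divr_ge0 ?(ltW (xgn _))//; apply: (us_ge0 ux); apply: DM => //; exact: DX.
Qed.

Let F_anti m n T : D T -> F (m + n) T <= F n T.
Proof.
move=> DT; rewrite /F exprD -mulrA ler_pdivrMr// addnC exprD [leRHS]mulrA divfK ?gt_eqF//.
rewrite mulrC -uniform_seminormX//; apply: usM => //; first exact: DX.
by apply: DM => //; exact: DX.
Qed.

Lemma smoothing_uniform : uniform_seminorm (smoothing x g).
Proof.
apply: (inf_seminorm_uniform 0%N) => //.
- by move=> n; rewrite mulr0 us0// mul0r.
- by move=> n; rewrite mulr1 uniform_seminormX// divff// gt_eqF.
- move=> i j S T DS DT; exists (i + j)%N.
  apply: (@le_trans _ _ (F (i + j) S + F (i + j) T)).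
    rewrite -mulrDl ler_wpM2r ?invr_ge0 ?(ltW (xgn _))// mulrBr usB//; apply: DM => //; exact: DX.
  by apply: lerD; [rewrite addnC|]; exact: F_anti.
- move=> i j S T DS DT; exists (i + j)%N.
  rewrite mulrACA -invfM -exprD ler_wpM2r ?invr_ge0 ?(ltW (xgn _))//.
  have -> : g ^+ (i + j) * (S * T) = (g ^+ i * S) * (g ^+ j * T).
    by rewrite exprD -!mulrA; congr *%R; rewrite !mulrA (DC DS (DX j Dg)).
  by apply: usM => //; apply: DM => //; exact: DX.
- move=> i T DT; exists i; apply: le_trans (F_anti i i (DX 2 DT)).
  rewrite /F expr_div_n -exprM addnn -muln2 ler_wpM2r ?invr_ge0 ?(ltW (xgn _))//.
  have -> : g ^+ (i * 2) * T ^+ 2 = (g ^+ i * T) ^+ 2.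
    by rewrite exprM exprMn_comm//; apply: DC => //; exact: DX.
  by rewrite us_sqr//; apply: DM => //; exact: DX.
Qed.

Lemma smoothing_le T : D T -> smoothing x g T <= x T.
Proof.
by move=> DT; rewrite (le_trans (inf_seminorm_le F_ge0 0%N DT))// /F !expr0 mul1r divr1.
Qed.

Lemma smoothingM T : D T -> smoothing x g (g * T) = x g * smoothing x g T.
Proof.
move=> DT; apply/eqP; rewrite eq_le; apply/andP; split.
  rewrite (le_trans (usM smoothing_uniform Dg DT))// ler_wpM2r ?smoothing_le//.
  exact: us_ge0 smoothing_uniform _ DT.
apply: (le_inf_seminorm 0%N) => n; rewrite mulrA -exprSr.
apply: le_trans (ler_wpM2l (ltW xg) (inf_seminorm_le F_ge0 n.+1 DT)) _.
by rewrite /F [x g ^+ _]exprS invfM mulrCA mulVKf ?gt_eqF.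
Qed.

Lemma smoothing_preserves f c : D f -> 0 <= c ->
  (forall T, D T -> x (f * T) = c * x T) ->
  forall T, D T -> smoothing x g (f * T) = c * smoothing x g T.
Proof.
move=> Df c0 xf T DT; have FE n : F n (f * T) = c * F n T.
  rewrite /F mulrA (DC (DX n Dg) Df) -mulrA xf ?mulrA//; apply: DM => //; exact: DX.
apply/eqP; rewrite eq_le; apply/andP; split.
  apply: (le_inf_seminormM 0%N) => // n; rewrite -FE.
  by apply: (inf_seminorm_le F_ge0); exact: DM.
apply: (le_inf_seminorm 0%N) => n; rewrite -/(F _ _) FE ler_wpM2l//.
exact: inf_seminorm_le.
Qed.

End Smoothing.

(** Among the uniform seminorms below N for which multiplication by f is
    multiplication by N f, take a minimal one x. Smoothing x at any g with
    x g > 0 cannot make it smaller, and therefore x is multiplicative in g. *)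
Lemma multiplicative_seminorm_attaining N f : uniform_seminorm N -> D f -> 0 < N f ->
  exists x, [/\ uniform_seminorm x, forall T, D T -> x T <= N T, x f = N f &
    forall S T, D S -> D T -> x (S * T) = x S * x T].
Proof.
move=> uN Df Nf.
pose good x := [/\ uniform_seminorm x, forall T, D T -> x T <= N T &
  forall T, D T -> x (f * T) = N f * x T].
have g0 : good (smoothing N f).
  by split; [exact: smoothing_uniform | exact: smoothing_le | exact: smoothingM].
pose le (x y : {x | good x}) := `[< forall T, D T -> sval y T <= sval x T >].
have [|||[x [ux xN xf]] xmin] := @ZL_preorder _ (exist _ _ g0) le.
- by move=> x; apply/asboolP.
- move=> y x z /asboolP xy /asboolP yz; apply/asboolP => T DT.
  exact: le_trans (yz T DT) (xy T DT).
- move=> C Ctot; have [[s0 Cs0]|C0] := pselect (exists s, C s); last first.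
    by exists (exist _ _ g0) => s Cs; case: C0; exists s.
  pose G (i : {s | C s}) : A -> R := sval (sval i).
  have Gu i : uniform_seminorm (G i) by case: (svalP (sval i)).
  have G_ge0 i T : D T -> 0 <= G i T by exact: us_ge0.
  have Gdir i j : exists k, forall T, D T -> G k T <= G i T /\ G k T <= G j T.
    have [/asboolP ij|/asboolP ji] := Ctot _ _ (svalP i) (svalP j).
      by exists j => T DT; split=> //; exact: ij.
    by exists i => T DT; split=> //; exact: ji.
  pose i0 : {s | C s} := exist _ s0 Cs0.
  have Gg : good (inf_seminorm G).
    split.
    + apply: (inf_seminorm_uniform i0) => //.
      * by move=> i; exact: us0.
      * by move=> i; exact: us1.
      * move=> i j S T DS DT; have [k kij] := Gdir i j; exists k.
        rewrite (le_trans (usB (Gu k) DS DT))//.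
        by apply: lerD; [have [] := kij S DS | have [] := kij T DT].
      * move=> i j S T DS DT; have [k kij] := Gdir i j; exists k.
        rewrite (le_trans (usM (Gu k) DS DT))//.
        by apply: ler_pM; rewrite ?G_ge0//; [have [] := kij S DS | have [] := kij T DT].
      * by move=> i T DT; exists i; rewrite us_sqr.
    + move=> T DT; apply: le_trans (inf_seminorm_le G_ge0 i0 DT) _.
      by case: (svalP s0) => _ + _; apply.
    + move=> T DT; have GE i : G i (f * T) = N f * G i T.
        by case: (svalP (sval i)) => _ _; apply.
      apply/eqP; rewrite eq_le; apply/andP; split.
        apply: (le_inf_seminormM i0); first exact: ltW.
        by move=> i; rewrite -GE; apply: (inf_seminorm_le G_ge0); exact: DM.
      by apply: (le_inf_seminorm i0) => i; rewrite GE ler_pM2l// inf_seminorm_le.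
  exists (exist _ _ Gg) => s Cs; apply/asboolP => T DT /=.
  exact: (inf_seminorm_le G_ge0 (exist _ s Cs)).
exists x; split=> //.
  by rewrite -[f in LHS]mulr1 xf// us1// mulr1.
move=> g T Dg DT; have := us_ge0 ux Dg; rewrite le_eqVlt => /predU1P[xg|xg].
  apply/eqP; rewrite eq_le usM//= -xg mul0r; apply: us_ge0 => //; exact: DM.
have xgood : good (smoothing x g).
  split; first exact: smoothing_uniform.
  - by move=> S DS; apply: le_trans (xN S DS); exact: smoothing_le.
  - by apply: smoothing_preserves => //; exact: ltW.
have xE S : D S -> smoothing x g S = x S.
  move=> DS; apply/eqP; rewrite eq_le smoothing_le//=.
  suff /asboolP : le (exist _ _ xgood) (exist _ _ (And3 ux xN xf)) by apply.
  by apply: xmin; apply/asboolP => U DU /=; exact: smoothing_le.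
by rewrite -!xE ?smoothingM ?xE//; exact: DM.
Qed.

End UniformSeminorms.
(** * The Banach algebra of bounded operators *)

Section UltraNorm.
Variables (R : realType) (K : valuedFieldType R) (B : ultraNormedType K).
Implicit Types (x y z : B) (c e : R).

Lemma unorm_distC x y : unorm (x - y) = unorm (y - x).
Proof. by rewrite -unormN opprB. Qed.

Lemma unormD_le c x y : unorm x <= c -> unorm y <= c -> unorm (x + y) <= c.
Proof. by move=> xc yc; rewrite (le_trans (unorm_ultra _ _))// ge_max xc. Qed.

Lemma unormB_le c x y : unorm x <= c -> unorm y <= c -> unorm (x - y) <= c.
Proof. by move=> xc yc; apply: unormD_le; rewrite ?unormN. Qed.

Lemma unorm_dist_trans y c x z :
  unorm (x - y) <= c -> unorm (y - z) <= c -> unorm (x - z) <= c.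
Proof. by move=> xy yz; rewrite -(subrK y x) -addrA unormD_le. Qed.

Lemma unorm_sum I (s : seq I) (P : pred I) (F : I -> B) c :
  0 <= c -> (forall i, P i -> unorm (F i) <= c) ->
  unorm (\sum_(i <- s | P i) F i) <= c.
Proof.
by move=> c0 Fc; elim/big_ind: _ => // [|x y]; [rewrite unorm0 | exact: unormD_le].
Qed.

Lemma unorm_small_eq0 x : (forall e, 0 < e -> unorm x <= e) -> x = 0.
Proof.
move=> h; apply/eqP; rewrite -unorm_eq0 eq_le unorm_ge0 andbT.
by apply/ler_addgt0Pl => e e0; rewrite addr0 h.
Qed.

End UltraNorm.

Section Operators.
Variables (R : realType) (K : valuedFieldType R) (B : ultraBanachType K).
Local Notation op := (bop B).
Implicit Types (S T A V : op) (P Q : {poly K}).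

Lemma opnormM S T : unorm (S * T) <= unorm S * unorm T.
Proof.
apply: opnorm_le => [|x]; first by rewrite mulr_ge0 ?unorm_ge0.
rewrite (le_trans (opnorm_ub S (T x)))// -mulrA ler_wpM2l ?opnorm_ge0//.
exact: opnorm_ub.
Qed.

Lemma opnorm1_le1 : unorm (1 : op) <= 1.
Proof. by apply: opnorm_le => // x; rewrite mul1r. Qed.

Lemma opnormX_le T n : unorm (T ^+ n) <= unorm T ^+ n.
Proof.
elim: n => [|n IH]; first exact: opnorm1_le1.
by rewrite !exprS (le_trans (opnormM _ _))// ler_wpM2l ?unorm_ge0.
Qed.

Lemma opscaleAl a S T : a *: (S * T) = (a *: S) * T.
Proof. exact: bop_eq. Qed.

Lemma opscaleAr a S T : a *: (S * T) = S * (a *: T).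
Proof.
apply: bop_eq => x; have := bop_linear S a (T x) 0.
have -> : S 0 = 0 by have := bop_add S 0 0; rewrite addr0 -{1}[S 0]addr0 => /addrI.
by rewrite !addr0 => h; exact: (esym h).
Qed.

Lemma op_complete : norm_complete (@unorm R K op).
Proof.
move=> u uc.
have lim_ex x : exists l : B, forall e : R, 0 < e -> exists k, forall n, (k <= n)%N ->
    unorm (u n x - l) < e.
  apply: unorm_complete => e e0.
  have [k kh] := uc (e / (unorm x + 1)) (divr_gt0 e0 (ltr_wpDl (unorm_ge0 x) ltr01)).
  exists k => m n km kn; rewrite -bopNE -bopDE (le_lt_trans (opnorm_ub _ _))//.
  have := kh m n km kn; rewrite ltr_pdivlMr ?ltr_wpDl ?unorm_ge0//; apply: le_lt_trans.
  by rewrite ler_wpM2l ?opnorm_ge0// lerDl.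
have [L Lh] := choice lim_ex.
have uL e : 0 < e -> exists k, forall n x, (k <= n)%N -> unorm (u n x - L x) <= e * unorm x.
  move=> e0; have [k kh] := uc e e0; exists k => n x kn.
  apply/ler_addgt0Pl => d d0; have [m mh] := Lh x d d0.
  apply: (@unorm_dist_trans _ _ _ (u (maxn k m) x)).
    rewrite -bopNE -bopDE (le_trans (opnorm_ub _ _))// ler_wpDl ?(ltW d0)//.
    by rewrite ler_wpM2r ?unorm_ge0// ltW// kh// leq_maxl.
  by rewrite ler_wpDr ?mulr_ge0 ?unorm_ge0 ?(ltW e0)// ltW// mh// leq_maxr.
have Llin : linear L.
  move=> a x y; apply/eqP; rewrite -subr_eq0; apply/eqP.
  apply: unorm_small_eq0 => e e0.
  (* a common bound for the norms that multiply the error of u k *)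
  pose c := (vabs a + 1) * (unorm x + 1) + (unorm y + 1) + unorm (a *: x + y).
  have c0 : 0 < c.
    apply: ltr_wpDr; first exact: unorm_ge0.
    by rewrite ltr_wpDl ?mulr_ge0 ?addr_ge0 ?unorm_ge0 ?vabs_ge0// ltr_wpDl ?unorm_ge0.
  have [k kh] := uL (e / c) (divr_gt0 e0 c0).
  have ec d : d <= c -> e / c * d <= e.
    by move=> dc; rewrite mulrAC ler_pdivrMr// ler_pM2l.
  apply: (@unorm_dist_trans _ _ _ (u k (a *: x + y))).
    rewrite unorm_distC (le_trans (kh k _ (leqnn k)))// ec//.
    by rewrite /c ler_wpDl// !addr_ge0 ?mulr_ge0 ?addr_ge0 ?unorm_ge0 ?vabs_ge0.
  rewrite bop_linear opprD addrACA -scalerBr unormD_le//.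
    rewrite unormZ (le_trans (ler_wpM2l (vabs_ge0 a) (kh k x (leqnn k))))//.
    rewrite mulrCA ec// /c -addrA ler_wpDr ?addr_ge0 ?unorm_ge0//.
    by rewrite ler_pM ?vabs_ge0 ?unorm_ge0 ?lerDl.
  rewrite (le_trans (kh k y (leqnn k)))// ec// /c -addrA ler_wpDl//.
    by rewrite mulr_ge0 ?addr_ge0 ?unorm_ge0 ?vabs_ge0.
  by rewrite -addrA lerDl addr_ge0 ?unorm_ge0.
have Lb : L \in @bounded_linear R K B.
  apply/asboolP; split=> //; have [k kh] := uL 1 ltr01.
  exists (Num.max 1 (unorm (u k))) => x.
  rewrite -[L x](subrK (u k x)) unormD_le//.
    rewrite unorm_distC (le_trans (kh k x (leqnn k)))//.
    by rewrite ler_wpM2r ?unorm_ge0// le_max lexx.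
  by rewrite (le_trans (opnorm_ub _ _))// ler_wpM2r ?unorm_ge0// le_max lexx orbT.
exists (Bop Lb) => e e0; have e20 : 0 < e / 2 by rewrite divr_gt0.
have [k kh] := uL _ e20; exists k => n kn.
apply: (@le_lt_trans _ _ (e / 2)); last by rewrite ltr_pdivrMr// ltr_pMr// ltr1n.
by apply: opnorm_le => [|x]; [exact: ltW | exact: kh].
Qed.

Definition op_invertible T : Prop := exists S, S * T = 1 /\ T * S = 1.

(** The inverse is the geometric series in 1 - T. *)
Lemma op_neumann T : unorm (1 - T) < 1 -> op_invertible T.
Proof.
set X := 1 - T => X1; have TX : T = 1 - X by rewrite subKr.
pose s n := \sum_(i < n) X ^+ i.
have sc m n : (n <= m)%N -> unorm (s m - s n) <= unorm X ^+ n.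
  move=> nm; rewrite /s -!(big_mkord xpredT (fun i => X ^+ i)).
  rewrite (big_cat_nat (n := n))//= addrAC subrr add0r.
  rewrite big_seq_cond; apply: unorm_sum; first by rewrite exprn_ge0 ?unorm_ge0.
  move=> i; rewrite mem_index_iota andbT => /andP[ni _].
  by rewrite (le_trans (opnormX_le _ _))// ler_wiXn2l ?unorm_ge0 ?ltW.
have [|S Sh] := op_complete (u := s).
  move=> e /(expr_small (unorm_ge0 X) X1)[k /(_ k (leqnn k)) ke].
  exists k => m n km kn; apply: le_lt_trans ke.
  by apply: (@unorm_dist_trans _ _ _ (s k)); [|rewrite unorm_distC]; exact: sc.
have sT n : s n * T = 1 - X ^+ n.
  rewrite TX mulrBr mulr1 mulr_suml; elim: n => [|n IH].
    by rewrite /s !big_ord0 expr0 !subrr.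
  by rewrite /s !big_ord_recr/= opprD addrACA IH -exprSr addrA subrK.
have Ts n : T * s n = 1 - X ^+ n.
  rewrite TX mulrBl mul1r mulr_sumr; elim: n => [|n IH].
    by rewrite /s !big_ord0 expr0 !subrr.
  by rewrite /s !big_ord_recr/= opprD addrACA IH -exprS addrA subrK.
have small e : 0 < e -> exists n, unorm (s n - S) * (unorm T + 1) <= e /\ unorm X ^+ n <= e.
  move=> e0; have T1 : 0 < unorm T + 1 by rewrite ltr_wpDl ?unorm_ge0.
  have [k kh] := expr_small (unorm_ge0 X) X1 e0.
  have [j jh] := Sh _ (divr_gt0 e0 T1).
  exists (maxn k j); split; last by rewrite ltW// kh// leq_maxl.
  by rewrite -ler_pdivlMr// ltW// jh// leq_maxr.
exists S; split; apply/eqP; rewrite -subr_eq0; apply/eqP/unorm_small_eq0 => e /small[n [n1 n2]].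
  apply: (@unorm_dist_trans _ _ _ (s n * T)).
    rewrite -mulrBl (le_trans (opnormM _ _))// (le_trans _ n1)// unorm_distC.
    by rewrite ler_wpM2l ?unorm_ge0// lerDl.
  by rewrite sT addrAC subrr add0r unormN (le_trans (opnormX_le _ _)).
apply: (@unorm_dist_trans _ _ _ (T * s n)).
  rewrite -mulrBr (le_trans (opnormM _ _))// (le_trans _ n1)// unorm_distC mulrC.
  by rewrite ler_wpM2l ?unorm_ge0// lerDl.
by rewrite Ts addrAC subrr add0r unormN (le_trans (opnormX_le _ _)).
Qed.

Lemma op_invertible_open T : op_invertible T ->
  exists2 e : R, 0 < e & forall T', unorm (T - T') < e -> op_invertible T'.
Proof.
move=> [S [ST TS]]; have S1 : 0 < unorm S + 1 by rewrite ltr_wpDl ?unorm_ge0.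
exists (unorm S + 1)^-1 => [|T' TT']; first by rewrite invr_gt0.
have small : unorm S * unorm (T - T') < 1.
  rewrite (le_lt_trans (_ : _ <= (unorm S + 1) * unorm (T - T')))//.
    by rewrite ler_wpM2r ?unorm_ge0// lerDl.
  by rewrite mulrC -ltr_pdivlMr// div1r.
have [|X [XST _]] := @op_neumann (S * T').
  by rewrite -ST -mulrBr (le_lt_trans (opnormM _ _)).
have [|Y [_ TSY]] := @op_neumann (T' * S).
  by rewrite -TS -mulrBl (le_lt_trans (opnormM _ _))// mulrC.
have XY : X * S = S * Y by rewrite -[LHS]mulr1 -TSY mulrA mulrA -(mulrA X) XST mul1r.
exists (X * S); split; first by rewrite -mulrA.
by rewrite XY mulrA.
Qed.

(** * Polynomials in an operator *)

Lemma poly_op_widen A P n : (size P <= n)%N ->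
  poly_op A P = \sum_(i < n) P`_i *: A ^+ i.
Proof.
move=> Pn; rewrite /poly_op (big_ord_widen n (fun i => P`_i *: A ^+ i))//.
rewrite big_mkcond; apply: eq_bigr => i _; case: ltnP => // iP.
by rewrite nth_default// scale0r.
Qed.

Lemma poly_opD A P Q : poly_op A (P + Q) = poly_op A P + poly_op A Q.
Proof.
pose n := maxn (size P) (size Q).
rewrite !(@poly_op_widen A _ n) ?leq_maxl ?leq_maxr ?size_polyD// -big_split/=.
by apply: eq_bigr => i _; rewrite coefD scalerDl.
Qed.

Lemma poly_opZ A a P : poly_op A (a *: P) = a *: poly_op A P.
Proof.
rewrite (@poly_op_widen A _ (size P)) ?size_scale_leq// scaler_sumr.
by apply: eq_bigr => i _; rewrite coefZ scalerA.
Qed.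

Lemma poly_opC A a : poly_op A a%:P = a *: (1 : op).
Proof. by rewrite (@poly_op_widen A _ 1) ?size_polyC_leq1// big_ord1 coefC. Qed.

Lemma poly_op_mulX A P : poly_op A (P * 'X) = poly_op A P * A.
Proof.
have [->|P0] := eqVneq P 0; first by rewrite mul0r /poly_op size_poly0 !big_ord0 mul0r.
rewrite /poly_op size_mulX// big_ord_recl coefMX/= scale0r add0r mulr_suml.
by apply: eq_bigr => i _; rewrite coefMX/= -opscaleAl -exprSr.
Qed.

Lemma poly_opM A P Q : poly_op A (P * Q) = poly_op A P * poly_op A Q.
Proof.
elim/poly_ind: Q => [|Q c IH].
  have p0 : poly_op A 0 = 0 by rewrite /poly_op size_poly0 big_ord0.
  by rewrite mulr0 p0 mulr0.
rewrite mulrDr mulrA !poly_opD !poly_op_mulX IH mulrDr mulrA; congr (_ + _).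
by rewrite mulrC mul_polyC poly_opZ poly_opC -opscaleAr mulr1.
Qed.

Lemma poly_opX A : poly_op A 'X = A.
Proof. by rewrite -['X]mul1r poly_op_mulX poly_opC scale1r mul1r. Qed.

Lemma opalgP A T : opalg A T <->
  forall e : R, 0 < e -> exists P, unorm (T - poly_op A P) < e.
Proof.
split => [h e e0|h].
  by have [|_ [[P _ <-] /=]] := h (ball T e); [exact: nbhsx_ballx | exists P].
move=> C /nbhs_ballP[e e0 eC]; have [P TP] := h e e0.
by exists (poly_op A P); split; [exists P | exact: eC].
Qed.

Lemma opalg_closed A T :
  (forall e : R, 0 < e -> exists2 S, opalg A S & unorm (T - S) <= e) -> opalg A T.
Proof.
move=> h; apply/opalgP => e e0; have e20 : 0 < e / 2 by rewrite divr_gt0.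
have ee : e / 2 < e by rewrite ltr_pdivrMr// ltr_pMr// ltr1n.
have [S /opalgP /(_ _ e20)[P SP] TS] := h _ e20; exists P.
by apply: le_lt_trans ee; apply: (unorm_dist_trans TS); rewrite ltW.
Qed.

Lemma opalg_poly A P : opalg A (poly_op A P).
Proof. by apply/opalgP => e e0; exists P; rewrite subrr unorm0. Qed.

Lemma opalg_id A : opalg A A.
Proof. by rewrite -{2}[A]poly_opX; exact: opalg_poly. Qed.

Lemma opalg1 A : opalg A 1.
Proof. by rewrite -[1 : op]scale1r -(poly_opC A); exact: opalg_poly. Qed.

Lemma opalgD A S T : opalg A S -> opalg A T -> opalg A (S + T).
Proof.
move=> /opalgP hS /opalgP hT; apply: opalg_closed => e e0.
have [P SP] := hS e e0; have [Q TQ] := hT e e0.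
exists (poly_op A (P + Q)); first exact: opalg_poly.
by rewrite poly_opD opprD addrACA unormD_le// ltW.
Qed.

Lemma opalgZ A a T : opalg A T -> opalg A (a *: T).
Proof.
move=> /opalgP hT; apply: opalg_closed => e e0.
have a1 : 0 < vabs a + 1 by rewrite ltr_wpDl ?vabs_ge0.
have [P TP] := hT _ (divr_gt0 e0 a1); exists (poly_op A (a *: P)); first exact: opalg_poly.
rewrite poly_opZ -scalerBr unormZ.
rewrite (le_trans (ler_wpM2r (unorm_ge0 _) (_ : vabs a <= vabs a + 1)))// ?lerDl//.
by rewrite mulrC -ler_pdivlMr// ltW.
Qed.

Lemma opalgB A S T : opalg A S -> opalg A T -> opalg A (S - T).
Proof. by move=> hS hT; rewrite -scaleN1r; apply: opalgD => //; exact: opalgZ. Qed.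

Lemma opalg0 A : opalg A 0.
Proof. by rewrite -(subrr 1); apply: opalgB; exact: opalg1. Qed.

Lemma op_mul_approx S T (e : R) : 0 < e -> exists2 d : R, 0 < d &
  forall S' T', unorm (S - S') <= d -> unorm (T - T') <= d ->
    unorm (S * T - S' * T') <= e.
Proof.
move=> e0; pose c := unorm S + unorm T + 1.
have c0 : 0 < c by rewrite ltr_wpDl ?addr_ge0 ?unorm_ge0.
have d0 : 0 < Num.min 1 (e / c) by rewrite lt_min ltr01 divr_gt0.
exists (Num.min 1 (e / c)) => // S' T'.
rewrite !le_min => /andP[S1 Se] /andP[T1 Te].
have S'c : unorm S' <= c.
  rewrite -[S'](subKr S) (le_trans (unormB_le (c := Num.max 1 (unorm S)) _ _))//.
  - by rewrite le_max lexx orbT.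
  - by rewrite le_max S1.
  - by rewrite ge_max /c lerDr addr_ge0 ?unorm_ge0//= -addrA lerDl addr_ge0 ?unorm_ge0.
have Tc : unorm T <= c.
  by rewrite /c [unorm S + _]addrC -addrA lerDl addr_ge0 ?unorm_ge0.
have -> : S * T - S' * T' = (S - S') * T + S' * (T - T').
  by rewrite mulrBl mulrBr addrA subrK.
apply: unormD_le; rewrite (le_trans (opnormM _ _))//.
  by rewrite (le_trans (ler_pM _ _ Se Tc)) ?unorm_ge0// divfK// gt_eqF.
by rewrite (le_trans (ler_pM _ _ S'c Te)) ?unorm_ge0// mulrC divfK// gt_eqF.
Qed.

Lemma opalgM A S T : opalg A S -> opalg A T -> opalg A (S * T).
Proof.
move=> /opalgP hS /opalgP hT; apply: opalg_closed => e e0.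
have [d d0 dh] := op_mul_approx S T e0.
have [P SP] := hS d d0; have [Q TQ] := hT d d0.
exists (poly_op A (P * Q)); first exact: opalg_poly.
by rewrite poly_opM; apply: dh; exact: ltW.
Qed.

Lemma opalgX A T n : opalg A T -> opalg A (T ^+ n).
Proof.
move=> hT; elim: n => [|n IH]; first exact: opalg1.
by rewrite exprS; exact: opalgM.
Qed.

Lemma opalg_sum A I (s : seq I) (P : pred I) (F : I -> op) :
  (forall i, P i -> opalg A (F i)) -> opalg A (\sum_(i <- s | P i) F i).
Proof. by move=> h; elim/big_ind: _ => //; [exact: opalg0 | exact: opalgD]. Qed.

Lemma opalgC A S T : opalg A S -> opalg A T -> S * T = T * S.
Proof.
move=> /opalgP hS /opalgP hT; apply/eqP; rewrite -subr_eq0; apply/eqP.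
apply: unorm_small_eq0 => e e0.
have [d1 d10 h1] := op_mul_approx S T e0; have [d2 d20 h2] := op_mul_approx T S e0.
have d0 : 0 < Num.min d1 d2 by rewrite lt_min d10.
have [P /ltW] := hS _ d0; have [Q /ltW] := hT _ d0; rewrite !le_min.
move=> /andP[Q1 Q2] /andP[P1 P2].
apply: (unorm_dist_trans (h1 _ _ P1 Q1)); rewrite unorm_distC.
by rewrite -poly_opM mulrC poly_opM; apply: h2.
Qed.

Lemma opalg_sub A V : opalg V A -> opalg A `<=` opalg V.
Proof.
move=> VA T /opalgP hT; apply: opalg_closed => e e0.
have [P /ltW TP] := hT e e0; exists (poly_op A P) => //.
by apply: opalg_sum => i _; apply: opalgZ; exact: opalgX.
Qed.

End Operators.
(** * The Gelfand transform *)

Section Seminorms.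
Variables (R : realType) (K : valuedFieldType R) (B : ultraBanachType K).
Local Notation op := (bop B).
Variables (A : op) (x : op -> R).
Hypothesis bx : bounded_mult_seminorm (opalg A) x.
Implicit Types (S T : op).

Lemma seminorm_expr T n : opalg A T -> x (T ^+ n) = x T ^+ n.
Proof.
move=> hT; elim: n => [|n IH]; first exact: bms1 bx.
by rewrite !exprS (bmsM bx) ?IH//; exact: opalgX.
Qed.

(** The bound x T <= C |T| applied to all powers of T improves C to 1. *)
Lemma seminorm_le_norm T : opalg A T -> x T <= unorm T.
Proof.
move=> hT; have [C Ch] := bms_bounded bx; rewrite leNgt; apply/negP => Tx.
have x0 : 0 < x T by rewrite (le_lt_trans (unorm_ge0 _) Tx).
have t0 : 0 <= unorm T / x T by rewrite divr_ge0 ?unorm_ge0 ?ltW.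
have t1 : unorm T / x T < 1 by rewrite ltr_pdivrMr// mul1r.
have C1 : 0 < `|C| + 1 by rewrite ltr_wpDl.
have C10 : 0 < (`|C| + 1)^-1 by rewrite invr_gt0.
have [n /(_ n (leqnn n))] := expr_small t0 t1 C10.
rewrite expr_div_n ltr_pdivrMr ?exprn_gt0// mulrC ltr_pdivlMr// ltNge => /negP; apply.
rewrite -seminorm_expr// (le_trans (Ch _ (opalgX hT)))//.
rewrite (le_trans (ler_wpM2r (unorm_ge0 _) (ler_norm C)))// mulrC.
by apply: ler_pM; rewrite ?unorm_ge0 ?opnormX_le// lerDl.
Qed.

Lemma seminormN T : opalg A T -> x (- T) = x T.
Proof.
have h S : opalg A S -> x (- S) <= x S.
  move=> hS; rewrite -sub0r (le_trans (bmsB bx (opalg0 A) hS))//.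
  by rewrite (bms0 bx) add0r.
move=> hT; apply/eqP; rewrite eq_le h//= -{1}[T]opprK h// -sub0r.
by apply: opalgB => //; exact: opalg0.
Qed.

Lemma seminormD_le S T : opalg A S -> opalg A T -> x (S + T) <= x S + x T.
Proof.
move=> hS hT; have hN : opalg A (- T) by rewrite -sub0r; apply: opalgB => //; exact: opalg0.
by rewrite -{1}[T]opprK (le_trans (bmsB bx hS hN))// seminormN.
Qed.

Lemma opalg_scalar a : opalg A (a *: (1 : op)).
Proof. by apply: opalgZ; exact: opalg1. Qed.

Lemma seminorm_scalar a : x (a *: (1 : op)) = vabs a.
Proof.
have xle b : x (b *: (1 : op)) <= vabs b.
  rewrite (le_trans (seminorm_le_norm (@opalg_scalar b)))// unormZ.
  by rewrite ler_piMr ?vabs_ge0// opnorm1_le1.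
have [->|a0] := eqVneq a 0; first by rewrite scale0r (bms0 bx) vabs0.
apply/eqP; rewrite eq_le xle/=.
have xx : x (a *: (1 : op)) * x (a^-1 *: (1 : op)) = 1.
  rewrite -(bmsM bx); [|exact: opalg_scalar..].
  by rewrite -opscaleAl mul1r scalerA divff// scale1r (bms1 bx).
have va : 0 < vabs a by rewrite vabs_gt0.
rewrite -[leLHS]mul1r -xx -mulrA ler_piMr ?(bms_ge0 bx)//; first exact: opalg_scalar.
by rewrite -ler_pdivlMr// div1r -vabsV.
Qed.

Lemma seminorm_dist_eq S T : opalg A S -> opalg A T -> x (S - T) = 0 -> x S = x T.
Proof.
move=> hS hT ST; have hST := opalgB hS hT; apply/eqP; rewrite eq_le.
rewrite -{1}[S](subrK T) (le_trans (seminormD_le hST hT)) ?ST ?add0r//=.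
by rewrite -{1}[T](subKr S) (le_trans (bmsB bx hS hST))// ST addr0.
Qed.

End Seminorms.

Section GelfandTransform.
Variables (R : realType) (K : completeValuedFieldType R) (B : ultraBanachType K).
Local Notation op := (bop B).
Variables (A : op) (h : K -> {ptws op -> R}).
Hypotheses (h_spec : forall l, spectrum A l -> bounded_mult_seminorm (opalg A) (h l))
  (h_eval : forall l, spectrum A l -> h l (A - l *: (1 : op)) = 0).
Implicit Types (S T : op) (P : {poly K}) (l : K).
Local Notation sigma := (spectrum A).

(** The value at l of the function on the spectrum that corresponds to T; the
    default value 0 is only taken where no such scalar exists, see gelfandP. *)
Definition gelfand T l : K := xget 0 [set a | h l (T - a *: (1 : op)) = 0].

Let opalg_sub_scalar T (a : K) : opalg A T -> opalg A (T - a *: (1 : op)).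
Proof. by move=> hT; apply: opalgB => //; exact: opalg_scalar. Qed.

Lemma seminorm_poly P l : sigma l -> h l (poly_op A P - P.[l] *: (1 : op)) = 0.
Proof.
move=> sl; have /factor_theorem[Q PQ] : root (P - P.[l]%:P) l.
  by rewrite rootE hornerD hornerN hornerC subrr.
have -> : poly_op A P - P.[l] *: (1 : op) = poly_op A Q * (A - l *: (1 : op)).
  have -> : poly_op A P - P.[l] *: (1 : op) = poly_op A (P - P.[l]%:P).
    by rewrite -polyCN poly_opD poly_opC scaleNr.
  by rewrite PQ poly_opM -polyCN poly_opD poly_opX poly_opC scaleNr.
rewrite (bmsM (h_spec sl)) ?h_eval ?mulr0//; first exact: opalg_poly.
by apply: opalg_sub_scalar; exact: opalg_id.
Qed.

Lemma gelfand_unique T l a b : sigma l -> opalg A T ->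
  h l (T - a *: (1 : op)) = 0 -> h l (T - b *: (1 : op)) = 0 -> a = b.
Proof.
move=> sl hT ha hb; have bx := h_spec sl.
apply/eqP; rewrite -subr_eq0 -vabs_eq0 -(seminorm_scalar bx).
have -> : (a - b) *: (1 : op) = (T - b *: (1 : op)) - (T - a *: (1 : op)).
  by rewrite scalerBl opprB [RHS]addrC addrA subrK.
rewrite eq_le (bms_ge0 bx) ?andbT.
  by rewrite (le_trans (bmsB bx _ _)) ?ha ?hb ?addr0//; exact: opalg_sub_scalar.
by apply: opalgB; exact: opalg_sub_scalar.
Qed.

(** The values at l of polynomials that approximate T form a Cauchy sequence,
    because a seminorm takes the value |a| at each scalar a. *)
Lemma gelfandP T l : sigma l -> opalg A T -> h l (T - gelfand T l *: (1 : op)) = 0.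
Proof.
move=> sl hT; have bx := h_spec sl.
suff [a ha] : exists a, h l (T - a *: (1 : op)) = 0.
  by apply: (@xgetPex _ 0 [set a | h l (T - a *: (1 : op)) = 0]); exists a.
have h0 : (0 : R) <= 2^-1 by rewrite invr_ge0.
have h1 : (2^-1 : R) < 1 by rewrite invf_lt1// ltr1n.
have Pex (n : nat) : exists P, unorm (T - poly_op A P) < 2^-1 ^+ n.
  by move/opalgP: hT; apply; rewrite exprn_gt0// invr_gt0.
have [P Ph] := choice Pex.
have Pval n a : h l (poly_op A (P n) - a *: (1 : op)) = vabs ((P n).[l] - a).
  rewrite -(seminorm_scalar bx); apply: (seminorm_dist_eq bx).
  - by apply: opalg_sub_scalar; exact: opalg_poly.
  - exact: opalg_scalar.
  - by rewrite scalerBl opprB addrA subrK seminorm_poly.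
have Pdist m n : vabs ((P m).[l] - (P n).[l]) <= unorm (poly_op A (P m) - poly_op A (P n)).
  rewrite -Pval -(@seminorm_dist_eq _ _ _ _ _ bx (poly_op A (P m) - poly_op A (P n))).
  - by apply: (seminorm_le_norm bx); apply: opalgB; exact: opalg_poly.
  - by apply: opalgB; exact: opalg_poly.
  - by apply: opalg_sub_scalar; exact: opalg_poly.
  - rewrite opprB addrC addrA subrK -opprB (seminormN bx) ?seminorm_poly//.
    by apply: opalg_sub_scalar; exact: opalg_poly.
have [|a ah] := @vabs_complete R K (fun n => (P n).[l]).
  move=> e e0; have [k kh] := expr_small h0 h1 e0; exists k => m n km kn.
  apply: le_lt_trans (Pdist m n) (le_lt_trans _ (kh k (leqnn k))).
  apply: (@unorm_dist_trans _ _ _ T); [rewrite unorm_distC|];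
    by rewrite (le_trans (ltW (Ph _)))// exprn_ile1_le// ltW.
exists a; have hTa := @opalg_sub_scalar T a hT.
apply/eqP; rewrite eq_le (bms_ge0 bx) // andbT.
apply/ler_addgt0Pl => e e0; rewrite addr0.
have e20 : 0 < e / 2 by rewrite divr_gt0.
have [k kh] := expr_small h0 h1 e20; have [j jh] := ah _ e20.
pose n := maxn k j.
have -> : T - a *: (1 : op) = (T - poly_op A (P n)) + (poly_op A (P n) - a *: (1 : op)).
  by rewrite addrA subrK.
rewrite (le_trans (seminormD_le bx _ _)).
- by [].
- by apply: opalgB => //; exact: opalg_poly.
- by apply: opalg_sub_scalar; exact: opalg_poly.
rewrite [leRHS]splitr lerD//; last by rewrite Pval ltW// jh// leq_maxr.
rewrite (le_trans (seminorm_le_norm bx _)).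
- by [].
- by apply: opalgB => //; exact: opalg_poly.
by rewrite (le_trans (ltW (Ph n)))// ltW// kh// leq_maxl.
Qed.

Lemma gelfand_eq T l a : sigma l -> opalg A T -> h l (T - a *: (1 : op)) = 0 ->
  gelfand T l = a.
Proof. by move=> sl hT; apply: gelfand_unique => //; exact: gelfandP. Qed.

Lemma gelfand_abs T l : sigma l -> opalg A T -> h l T = vabs (gelfand T l).
Proof.
move=> sl hT; rewrite -(seminorm_scalar (h_spec sl)).
by apply: (seminorm_dist_eq (h_spec sl)) => //; [exact: opalg_scalar | exact: gelfandP].
Qed.

Lemma gelfand_le_norm T l : sigma l -> opalg A T -> vabs (gelfand T l) <= unorm T.
Proof.
by move=> sl hT; rewrite -gelfand_abs//; exact: seminorm_le_norm (h_spec sl) _ hT.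
Qed.

Lemma gelfand_poly P l : sigma l -> gelfand (poly_op A P) l = P.[l].
Proof. by move=> sl; apply: gelfand_eq => //; [exact: opalg_poly | exact: seminorm_poly]. Qed.

Lemma gelfandD S T l : sigma l -> opalg A S -> opalg A T ->
  gelfand (S + T) l = gelfand S l + gelfand T l.
Proof.
move=> sl hS hT; have bx := h_spec sl; apply: gelfand_eq => //; first exact: opalgD.
rewrite scalerDl opprD addrACA; apply/eqP; rewrite eq_le (bms_ge0 bx) ?andbT.
  rewrite (le_trans (seminormD_le bx _ _)) ?gelfandP ?addr0//; exact: opalg_sub_scalar.
by apply: opalgD; exact: opalg_sub_scalar.
Qed.

Lemma gelfandM S T l : sigma l -> opalg A S -> opalg A T ->
  gelfand (S * T) l = gelfand S l * gelfand T l.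
Proof.
move=> sl hS hT; have bx := h_spec sl; apply: gelfand_eq => //; first exact: opalgM.
set a := gelfand S l; set b := gelfand T l.
have -> : S * T - (a * b) *: (1 : op) =
    (S - a *: (1 : op)) * T + (a *: (1 : op)) * (T - b *: (1 : op)).
  by rewrite mulrBl mulrBr addrA subrK -opscaleAr mulr1 scalerA mulrC.
have hSa := @opalg_sub_scalar S a hS; have hTb := @opalg_sub_scalar T b hT.
have ha := @opalg_scalar R K B A a.
apply/eqP; rewrite eq_le (bms_ge0 bx) ?andbT; last by apply: opalgD; exact: opalgM.
rewrite (le_trans (seminormD_le bx (opalgM _ _) (opalgM _ _)))//.
by rewrite !(bmsM bx)// !gelfandP// mulr0 mul0r addr0.
Qed.

Lemma gelfand_scalar a l : sigma l -> gelfand (a *: (1 : op)) l = a.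
Proof.
move=> sl; apply: gelfand_eq => //; first exact: opalg_scalar.
by rewrite subrr (bms0 (h_spec sl)).
Qed.

Lemma gelfandZ a T l : sigma l -> opalg A T -> gelfand (a *: T) l = a * gelfand T l.
Proof.
move=> sl hT; rewrite -{1}[T]mul1r opscaleAl gelfandM//; last exact: opalg_scalar.
by rewrite gelfand_scalar.
Qed.

Lemma gelfand1 l : sigma l -> gelfand 1 l = 1.
Proof. by move=> sl; rewrite -[1 in LHS]scale1r gelfand_scalar. Qed.

Lemma gelfandX T n l : sigma l -> opalg A T -> gelfand (T ^+ n) l = gelfand T l ^+ n.
Proof.
move=> sl hT; elim: n => [|n IH]; first exact: gelfand1.
by rewrite !exprS gelfandM ?IH//; exact: opalgX.
Qed.

Lemma gelfandB S T l : sigma l -> opalg A S -> opalg A T ->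
  gelfand (S - T) l = gelfand S l - gelfand T l.
Proof.
by move=> sl hS hT; rewrite -scaleN1r gelfandD ?gelfandZ ?mulN1r//; exact: opalgZ.
Qed.

Lemma gelfand_id l : sigma l -> gelfand A l = l.
Proof. by move=> sl; rewrite -{1}[A]poly_opX gelfand_poly// hornerX. Qed.

End GelfandTransform.
(** * Isometry and surjectivity of the Gelfand transform *)

Section GelfandIsometry.
Variables (R : realType) (K : completeValuedFieldType R) (B : ultraBanachType K).
Local Notation op := (bop B).
Variables (A : op) (h : K -> {ptws op -> R}) (g : {ptws op -> R} -> K).
Hypotheses (A_uniform : uniform_alg (opalg A))
  (sigma_neq0 : spectrum A !=set0)
  (h_spec : forall l, spectrum A l -> bounded_mult_seminorm (opalg A) (h l))
  (h_eval : forall l, spectrum A l -> h l (A - l *: (1 : op)) = 0)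
  (g_spec : forall x, bounded_mult_seminorm (opalg A) x -> spectrum A (g x))
  (gK : forall x, bounded_mult_seminorm (opalg A) x -> h (g x) = x).
Implicit Types (S T : op) (P : {poly K}) (l : K).
Local Notation sigma := (spectrum A).
Local Notation gelf := (gelfand h).

Lemma opnorm_uniform_seminorm : uniform_seminorm (opalg A) (@unorm R K op).
Proof.
have [l sl] := sigma_neq0; split.
- by move=> T _; exact: unorm_ge0.
- exact: unorm0.
- apply/eqP; rewrite eq_le opnorm1_le1/= -[leLHS](bms1 (h_spec sl)).
  by apply: (seminorm_le_norm (h_spec sl)); exact: opalg1.
- by move=> S T _ _; rewrite unormB_le// ?lerDl ?lerDr ?unorm_ge0.
- by move=> S T _ _; exact: opnormM.
- exact: A_uniform.
Qed.

(** A multiplicative seminorm that attains the norm of T is a point of the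
    Berkovich spectrum, that is, the evaluation at a point of the spectrum. *)
Lemma gelfand_norm_attained T : opalg A T ->
  exists2 l, sigma l & unorm T = vabs (gelf T l).
Proof.
move=> hT; have := unorm_ge0 T; rewrite le_eqVlt => /predU1P[T0|T0].
  have [l sl] := sigma_neq0; exists l => //; apply/eqP; rewrite -T0 eq_le vabs_ge0/=.
  by rewrite [leRHS]T0; exact: (gelfand_le_norm h_spec h_eval).
have [x [ux xN xT xM]] := multiplicative_seminorm_attaining (opalg1 A)
  (fun S T => @opalgB R K B A S T) (fun S T => @opalgM R K B A S T)
  (fun S T => @opalgC R K B A S T) opnorm_uniform_seminorm hT T0.
(* points of the Berkovich spectrum vanish off the algebra by convention *)
pose y : {ptws op -> R} := fun S => if `[< opalg A S >] then x S else 0.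
have yE S : opalg A S -> y S = x S by rewrite /y => /asboolP ->.
have by_ : bounded_mult_seminorm (opalg A) y.
  split.
  - by move=> S; rewrite /y; case: asboolP.
  - by move=> S hS; rewrite yE//; exact: (us_ge0 ux).
  - by rewrite yE ?(us0 ux)//; exact: opalg0.
  - by rewrite yE ?(us1 ux)//; exact: opalg1.
  - by move=> S S' hS hS'; rewrite !yE ?(usB ux)//; exact: opalgB.
  - by move=> S S' hS hS'; rewrite !yE ?xM//; exact: opalgM.
  - by exists 1 => S hS; rewrite mul1r yE ?xN.
exists (g y); first exact: g_spec.
rewrite -(gelfand_abs h_spec h_eval)//; last exact: g_spec.
by rewrite gK// yE.
Qed.

Lemma opnorm_le_gelfand T (c : R) : opalg A T ->
  (forall l, sigma l -> vabs (gelf T l) <= c) -> unorm T <= c.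
Proof. by move=> /gelfand_norm_attained[l sl ->]; apply. Qed.

Lemma gelfand_inj S T : opalg A S -> opalg A T ->
  (forall l, sigma l -> gelf S l = gelf T l) -> S = T.
Proof.
move=> hS hT ST; apply/eqP; rewrite -subr_eq0; apply/eqP; apply: unorm_small_eq0 => e e0.
apply: opnorm_le_gelfand => [|l sl]; first exact: opalgB.
by rewrite (gelfandB h_spec h_eval)// ST// subrr vabs0 ltW.
Qed.

Lemma gelfand_continuous T : opalg A T -> {within sigma, continuous (gelf T)}.
Proof.
move=> hT; apply: (@within_uniform_limit R K sigma (gelf T)) => e e0.
move/opalgP: (hT) => /(_ e e0)[P PT]; exists (horner P).
  exact: horner_within_continuous.
move=> l sl; rewrite -(gelfand_poly h_spec h_eval P sl).
have hP := @opalg_poly R K B A P.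
rewrite -(gelfandB h_spec h_eval)//; apply: le_lt_trans PT.
by apply: (gelfand_le_norm h_spec h_eval) => //; exact: opalgB.
Qed.

(** The image of the Gelfand transform, for functions considered on the
    spectrum only. It is a closed subalgebra since the transform is an isometry
    and the space of operators is complete. *)
Definition gelfand_image (phi : K -> K) : Prop :=
  exists2 T, opalg A T & forall l, sigma l -> gelf T l = phi l.

Lemma gelfand_image_closed phi :
  (forall e : R, 0 < e -> exists2 psi, gelfand_image psi &
     forall l, sigma l -> vabs (phi l - psi l) <= e) ->
  gelfand_image phi.
Proof.
move=> ph.
have h0 : (0 : R) <= 2^-1 by rewrite invr_ge0.
have h1 : (2^-1 : R) < 1 by rewrite invf_lt1// ltr1n.
have Tex (n : nat) : exists T, opalg A T /\
    forall l, sigma l -> vabs (phi l - gelf T l) <= 2^-1 ^+ n.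
  have [|psi [T hT Tpsi] pp] := ph (2^-1 ^+ n); first by rewrite exprn_gt0// invr_gt0.
  by exists T; split=> // l sl; rewrite Tpsi// pp.
have [T Th] := choice Tex.
have hTn n : opalg A (T n) by case: (Th n).
have Tphi n l : sigma l -> vabs (phi l - gelf (T n) l) <= 2^-1 ^+ n by case: (Th n) => _; apply.
have [|S Slim] := @op_complete R K B T.
  move=> e e0; have [k kh] := expr_small h0 h1 e0; exists k => m n km kn.
  apply: le_lt_trans (kh k (leqnn k)).
  apply: opnorm_le_gelfand => [|l sl]; first exact: opalgB.
  rewrite (gelfandB h_spec h_eval)//; apply: (@vdist_trans _ _ (phi l)); [rewrite vdistC|];
    by rewrite (le_trans (Tphi _ _ sl))// exprn_ile1_le// ltW.
have hS : opalg A S.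
  apply: opalg_closed => e e0; have [k kh] := Slim e e0; exists (T k) => //.
  by rewrite unorm_distC ltW// kh.
exists S => // l sl; apply/eqP; rewrite -subr_eq0; apply/eqP; apply: vabs_small_eq0 => e e0.
have [k kh] := expr_small h0 h1 e0; have [j jh] := Slim e e0.
apply: (@vdist_trans _ _ (gelf (T (maxn k j)) l)).
  rewrite -(gelfandB h_spec h_eval)// (le_trans (gelfand_le_norm h_spec h_eval sl _))//.
    exact: opalgB.
  by rewrite unorm_distC ltW// jh// leq_maxr.
by rewrite vdistC (le_trans (Tphi _ _ sl))// ltW// kh// leq_maxl.
Qed.

Lemma gelfand_image_cst c : gelfand_image (fun=> c).
Proof.
exists (c *: (1 : op)); first exact: opalg_scalar.
by move=> l sl; exact: (gelfand_scalar h_spec).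
Qed.

Lemma gelfand_imageM phi psi : gelfand_image phi -> gelfand_image psi ->
  gelfand_image (fun l => phi l * psi l).
Proof.
move=> [S hS Sp] [T hT Tp]; exists (S * T); first exact: opalgM.
by move=> l sl; rewrite (gelfandM h_spec h_eval)// Sp// Tp.
Qed.

Lemma gelfand_imageB phi psi : gelfand_image phi -> gelfand_image psi ->
  gelfand_image (fun l => phi l - psi l).
Proof.
move=> [S hS Sp] [T hT Tp]; exists (S - T); first exact: opalgB.
by move=> l sl; rewrite (gelfandB h_spec h_eval)// Sp// Tp.
Qed.

Lemma gelfand_imageX phi n : gelfand_image phi -> gelfand_image (fun l => phi l ^+ n).
Proof.
move=> [T hT Tp]; exists (T ^+ n); first exact: opalgX.
by move=> l sl; rewrite (gelfandX h_spec h_eval)// Tp.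
Qed.

Lemma gelfand_image_sum n (F : 'I_n -> K -> K) : (forall i, gelfand_image (F i)) ->
  gelfand_image (fun l => \sum_(i < n) F i l).
Proof.
elim: n F => [|n IH] F hF.
  have [T hT Tp] := gelfand_image_cst 0; exists T => // l sl.
  by rewrite big_ord0 Tp.
have [S hS Sp] := IH _ (fun i => hF (widen_ord (leqnSn n) i)); have [T hT Tp] := hF ord_max.
exists (S + T); first exact: opalgD.
by move=> l sl; rewrite big_ord_recr/= (gelfandD h_spec h_eval)// Sp// Tp.
Qed.

Lemma gelfand_image_id : gelfand_image id.
Proof. by exists A; [exact: opalg_id | move=> l sl; exact: (gelfand_id h_spec h_eval)]. Qed.

Section PadicSpectrum.
Variable p : nat.
Hypotheses (p_prime : prime p) (p_lt1 : vabs (p%:R : K) < 1)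
  (p_neq0 : p%:R != 0 :> K) (sigma_zp : forall l, sigma l -> zp p l)
  (sigma_compact : compact sigma).
Local Notation r := (vabs (p%:R : K)).

(** The indicator of the ball of radius |p| ^ k.+1 around a is, on the ball of
    radius |p| ^ k, the indicator of |u| < 1 for the p-adic integer
    u = (l - a) / p ^ k, and this one is the limit of 1 - u ^ phi(p ^ n). *)
Lemma gelfand_image_ball k a :
  gelfand_image (fun l => if vabs (l - a%:R) <= r ^+ k then 1 else 0).
Proof.
have r0 : 0 < r by rewrite vabs_gt0.
elim: k => [|k IH].
  have [T hT Tp] := gelfand_image_cst 1; exists T => // l sl.
  by rewrite Tp// expr0 vabsB_le ?vabs_nat// (zp_le1 (sigma_zp sl)).
apply: gelfand_image_closed => e e0.
have [n ne] := r_small p_lt1 p_neq0 e0.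
exists (fun l => (if vabs (l - a%:R) <= r ^+ k then 1 else 0) *
    (1 - ((l - a%:R) * (p%:R ^+ k)^-1) ^+ totient (p ^ n))).
  apply: gelfand_imageM => //; apply: gelfand_imageB; first exact: gelfand_image_cst.
  apply: gelfand_imageX; apply: gelfand_imageM; last exact: gelfand_image_cst.
  by apply: gelfand_imageB; [exact: gelfand_image_id | exact: gelfand_image_cst].
move=> l sl; case: ifPn => lk1; last first.
  case: ifPn => lk; last by rewrite mul0r subrr vabs0 ltW.
  have uz := zp_div p_prime p_lt1 p_neq0 (sigma_zp sl) lk.
  rewrite mul1r sub0r vabsN vdistC (le_trans _ (ltW ne))//.
  have [u1|ur] := zp_unit_or_small p_prime p_lt1 p_neq0 uz; first exact: zp_euler.
  move: lk1; rewrite -ltNge => lk1; move: ur; rewrite vabsM vabsV vabsX.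
  by rewrite ler_pdivrMr ?exprn_gt0// -exprS leNgt lk1.
have lk : vabs (l - a%:R) <= r ^+ k by rewrite (le_trans lk1)// exprn_ile1_le// ltW.
rewrite lk mul1r subKr (le_trans _ (ltW ne))// zp_small_totient//.
by rewrite vabsM vabsV vabsX ler_pdivrMr ?exprn_gt0// -exprS.
Qed.

(** A continuous function on the compact spectrum is uniformly continuous,
    hence a uniform limit of linear combinations of indicators of balls. *)
Lemma gelfand_surjective phi : {within sigma, continuous phi} -> gelfand_image phi.
Proof.
move=> phic; apply: gelfand_image_closed => e e0.
have [d d0 dh] := compact_uniformly_continuous sigma_compact phic e0.
have [k kd] := r_small p_lt1 p_neq0 d0.
pose near_ (a : nat) l := sigma l /\ vabs (l - a%:R) <= r ^+ k.
pose c a := phi (xget 0 (near_ a)).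
exists (fun l => \sum_(a < p ^ k) c a * (if vabs (l - a%:R) <= r ^+ k then 1 else 0)).
  apply: gelfand_image_sum => a; apply: gelfand_imageM; first exact: gelfand_image_cst.
  exact: gelfand_image_ball.
move=> l sl; have [m lm] := sigma_zp sl k.
have pk0 : (0 < p ^ k)%N by rewrite expn_gt0 prime_gt0.
have la : vabs (l - (m %% p ^ k)%:R) <= r ^+ k.
  by apply: (vdist_trans lm); rewrite -(eqmod_vdist p_prime)// modn_mod.
rewrite (bigD1 (Ordinal (ltn_pmod m pk0)))//= la mulr1 big1 ?addr0.
  have [sx xa] : near_ (m %% p ^ k)%N (xget 0 (near_ (m %% p ^ k)%N)).
    by apply: (@xgetPex _ 0 (near_ (m %% p ^ k)%N)); exists l.
  apply/ltW/dh => //; apply: le_lt_trans kd.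
  by apply: (vdist_trans la); rewrite vdistC.
move=> b bm; case: ifPn => lb; rewrite ?mulr0//; case/eqP: bm; apply: val_inj => /=.
have : (b == m %% p ^ k %[mod p ^ k])%N.
  by rewrite (eqmod_vdist p_prime p_lt1)//; apply: (@vdist_trans _ _ l) => //; rewrite vdistC.
by rewrite modn_mod modn_small// => /eqP.
Qed.

Lemma gelfand_spectral_iso : spectral_iso A gelf.
Proof.
split.
- exact: gelfand_continuous.
- exact: (gelfand1 h_spec).
- by move=> S T hS hT l sl; exact: (gelfandD h_spec h_eval).
- by move=> S T hS hT l sl; exact: (gelfandM h_spec h_eval).
- by move=> a T hT l sl; exact: (gelfandZ h_spec h_eval).
- move=> T hT; have [l sl TE] := gelfand_norm_attained hT.
  have Tub : ubound [set vabs (gelf T l) | l in sigma] (unorm T).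
    by move=> _ [l' sl' <-]; exact: (gelfand_le_norm h_spec h_eval).
  apply/eqP; rewrite eq_le; apply/andP; split.
    by rewrite {1}TE; apply: ub_le_sup; [exists (unorm T) | exists l].
  by apply: ge_sup => //; exists (vabs (gelf T l)), l.
- exact: gelfand_surjective.
- exact: (gelfand_id h_spec h_eval).
Qed.

End PadicSpectrum.
End GelfandIsometry.
(** * Other generators of the algebra of a strongly normal operator *)

Lemma within_continuous_comp (T U W : topologicalType) (A : set T) (B : set U)
    (f : T -> U) (k : U -> W) : {homo f : x / A x >-> B x} ->
  {within A, continuous f} -> {within B, continuous k} ->
  {within A, continuous (k \o f)}.
Proof.
move=> AB /subspace_continuousP fc /subspace_continuousP kc.
apply/subspace_continuousP => x Ax; apply: cvg_comp (kc _ (AB _ Ax)) => C.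
rewrite /within/= => /(fc x Ax); rewrite /nbhs/= /within/=.
by apply: filterS => y h Ay; apply: h => //; exact: AB.
Qed.

Section Generators.
Variables (R : realType) (K : completeValuedFieldType R) (B : ultraBanachType K).
Local Notation op := (bop B).
Variables (V : op) (h : K -> {ptws op -> R}) (g : {ptws op -> R} -> K).
Hypotheses (V_uniform : uniform_alg (opalg V))
  (sigma_neq0 : spectrum V !=set0)
  (h_spec : forall l, spectrum V l -> bounded_mult_seminorm (opalg V) (h l))
  (h_eval : forall l, spectrum V l -> h l (V - l *: (1 : op)) = 0)
  (g_spec : forall x, bounded_mult_seminorm (opalg V) x -> spectrum V (g x))
  (gK : forall x, bounded_mult_seminorm (opalg V) x -> h (g x) = x).
Implicit Types (S T : op) (P : {poly K}) (l m : K).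
Local Notation sigma := (spectrum V).
Local Notation gelf := (gelfand h).

Variable p : nat.
Hypotheses (p_prime : prime p) (p_lt1 : vabs (p%:R : K) < 1)
  (p_neq0 : p%:R != 0 :> K) (sigma_zp : forall l, sigma l -> zp p l)
  (sigma_compact : compact sigma).

(** If V - l is not invertible, then neither is P(V) - P(l), for any polynomial
    P; the invertible operators form an open set. *)
Lemma spectrum_gelfand_sub T l : opalg V T -> sigma l -> spectrum T (gelf T l).
Proof.
move=> hT sl /op_invertible_open[e e0 inv]; apply: (sl).
move/opalgP: (hT) => /(_ e e0)[P PT].
have hP := @opalg_poly R K B V P.
have /factor_theorem[Q PQ] : root (P - P.[l]%:P) l.
  by rewrite rootE hornerD hornerN hornerC subrr.
have PE (C : op) (D : K) : poly_op C (P - D%:P) = poly_op C P - D *: (1 : op).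
  by rewrite -polyCN poly_opD poly_opC scaleNr.
have XE : poly_op V ('X - l%:P) = V - l *: (1 : op).
  by rewrite -polyCN poly_opD poly_opX poly_opC scaleNr.
have [S [SP PS]] : op_invertible (poly_op V P - P.[l] *: (1 : op)).
  apply: inv; have -> : T - gelf T l *: (1 : op) - (poly_op V P - P.[l] *: (1 : op)) =
      (T - poly_op V P) - (gelf T l - P.[l]) *: (1 : op).
    by rewrite scalerBl !opprB [_ *: _ - poly_op _ _]addrC addrACA [- _ + _]addrC.
  apply: le_lt_trans PT; rewrite unormB_le// unormZ.
  rewrite (le_trans (ler_piMr (vabs_ge0 _) (opnorm1_le1 B)))//.
  rewrite -(gelfand_poly h_spec h_eval P sl) -(gelfandB h_spec h_eval)//.
  by apply: (gelfand_le_norm h_spec h_eval) => //; exact: opalgB.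
have PX : poly_op V P - P.[l] *: (1 : op) = poly_op V Q * (V - l *: (1 : op)).
  by rewrite -PE PQ poly_opM XE.
have PX' : poly_op V P - P.[l] *: (1 : op) = (V - l *: (1 : op)) * poly_op V Q.
  by rewrite -PE PQ mulrC poly_opM XE.
have SQX : S * poly_op V Q * (V - l *: (1 : op)) = 1 by rewrite -mulrA -PX.
have XQS : (V - l *: (1 : op)) * (poly_op V Q * S) = 1 by rewrite mulrA -PX'.
exists (S * poly_op V Q); split=> //.
suff -> : S * poly_op V Q = poly_op V Q * S by [].
by rewrite -[LHS]mulr1 -XQS mulrA SQX mul1r.
Qed.

(** If the Gelfand transform of T avoids m, then its difference with m has a
    continuous inverse, which is the transform of an inverse of T - m. *)
Lemma spectrum_gelfand T : opalg V T -> spectrum T = gelf T @` sigma.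
Proof.
move=> hT; apply/seteqP; split => [m sm|_ [l sl <-]]; last exact: spectrum_gelfand_sub.
apply: contrapT => nm; apply: sm.
have gTm l : sigma l -> gelf T l - m != 0.
  by move=> sl; rewrite subr_eq0; apply/eqP => gm; apply: nm; exists l.
have hTm : opalg V (T - m *: (1 : op)) by apply: opalgB => //; exact: opalg_scalar.
have gE l : sigma l -> gelf (T - m *: (1 : op)) l = gelf T l - m.
  move=> sl; rewrite (gelfandB h_spec h_eval)// ?(gelfand_scalar h_spec)//.
  exact: opalg_scalar.
have gc := gelfand_continuous h_spec h_eval hTm.
have [|S hS Sg] := gelfand_surjective V_uniform sigma_neq0 h_spec h_eval g_spec gK
  p_prime p_lt1 p_neq0 sigma_zp sigma_compact (within_continuousV gc _).
  by move=> l sl; rewrite gE// gTm.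
have ST : S * (T - m *: (1 : op)) = 1.
  apply: (gelfand_inj V_uniform sigma_neq0 h_spec h_eval g_spec gK).
  - exact: opalgM.
  - exact: opalg1.
  move=> l sl; rewrite (gelfandM h_spec h_eval)// Sg// (gelfand1 h_spec)//.
  by rewrite mulVf// gE// gTm.
by exists S; split=> //; rewrite (opalgC hTm hS).
Qed.

Lemma gelfand_poly_op T P l : sigma l -> opalg V T ->
  gelf (poly_op T P) l = P.[gelf T l].
Proof.
move=> sl hT; elim/poly_ind: P => [|P c IH].
  by rewrite -[0]polyC0 poly_opC (gelfand_scalar h_spec)// hornerC.
have hP : opalg V (poly_op T P).
  by apply: opalg_sum => i _; apply: opalgZ; exact: opalgX.
rewrite poly_opD poly_op_mulX poly_opC hornerMXaddC.
rewrite (gelfandD h_spec h_eval)//; [|exact: opalgM|exact: opalg_scalar].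
by rewrite (gelfandM h_spec h_eval)// IH (gelfand_scalar h_spec).
Qed.

Hypotheses (V_chars : characters_in_base (opalg V))
  (hK : forall l, sigma l -> g (h l) = l)
  (h_cont : {within sigma, continuous h})
  (g_cont : {within berkovich_spectrum (opalg V), continuous g}).

(** All operators that generate the same algebra have the same Berkovich
    spectrum, and the Gelfand transform of one of them identifies it with the
    spectrum of that operator. *)
Lemma strongly_normal_generator A : opalg V A -> opalg A V -> strongly_normal A.
Proof.
move=> hA hV; have AE : opalg A = opalg V.
  by apply/seteqP; split; exact: opalg_sub.
have sE := spectrum_gelfand hA.
have gAc := gelfand_continuous h_spec h_eval hA.
(* V is a limit of polynomials in A; on the spectrum of V this makes the
   identity a uniform limit of polynomials in the transform of A, which is
   therefore injective with a continuous inverse *)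
have VP (e : R) : 0 < e -> exists P, forall l, sigma l -> vabs (l - P.[gelf A l]) < e.
  move=> e0; move/opalgP: (hV) => /(_ e e0)[P PV]; exists P => l sl.
  rewrite -gelfand_poly_op// -{1}(gelfand_id h_spec h_eval sl).
  have hVV := @opalg_id R K B V.
  have hP : opalg V (poly_op A P) by rewrite -AE; exact: opalg_poly.
  rewrite -(gelfandB h_spec h_eval)//; apply: le_lt_trans PV.
  by apply: (gelfand_le_norm h_spec h_eval) => //; exact: opalgB.
have gA_inj l l' : sigma l -> sigma l' -> gelf A l = gelf A l' -> l = l'.
  move=> sl sl' ll'; apply/eqP; rewrite -subr_eq0; apply/eqP; apply: vabs_small_eq0 => e e0.
  have [P Ph] := VP e e0; apply/ltW/(vdist_lt_trans (Ph l sl)).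
  by rewrite ll' vdistC Ph.
pose inv m := xget 0 [set l | sigma l /\ gelf A l = m].
have invP m : spectrum A m -> sigma (inv m) /\ gelf A (inv m) = m.
  rewrite sE => -[l sl lm]; apply: (@xgetPex _ 0 [set l | sigma l /\ gelf A l = m]).
  by exists l.
have invK l : sigma l -> inv (gelf A l) = l.
  move=> sl; have [|si gi] := invP (gelf A l); first by rewrite sE; exists l.
  exact: gA_inj.
have inv_cont : {within spectrum A, continuous inv}.
  apply: (@within_uniform_limit R K (spectrum A) inv) => e e0; have [P Ph] := VP e e0.
  exists (horner P); first exact: horner_within_continuous.
  by move=> m /invP[si gi]; rewrite -{2}gi Ph.
split.
- by split; rewrite AE.
- by have [l sl] := sigma_neq0; exists (gelf A l); rewrite sE; exists l.
- by rewrite sE; exact: continuous_compact.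
- exact: ultrametric_totally_disconnected.
exists (h \o inv), (gelf A \o g); split.
- by move=> m /invP[si _]; rewrite AE; exact: h_spec.
- by move=> x; rewrite AE => /g_spec sx; rewrite sE; exists (g x).
- by move=> m /invP[si gi] /=; rewrite hK.
- by move=> x; rewrite AE => Mx /=; rewrite invK ?gK//; exact: g_spec.
split.
- by apply: within_continuous_comp inv_cont h_cont => m /invP[].
- rewrite AE; apply: within_continuous_comp g_cont gAc => x; exact: g_spec.
- move=> m /invP[si gi] /=.
  rewrite (gelfand_abs h_spec h_eval si); last first.
    by rewrite -AE; apply: opalgB; [exact: opalg_id | exact: opalg_scalar].
  rewrite (gelfandB h_spec h_eval)//; last exact: opalg_scalar.
  by rewrite gi (gelfand_scalar h_spec)// subrr vabs0.
Qed.

End Generators.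
(** * The logarithm to the base 1 + p of a unitary operator *)

Section Logarithm.
Variables (R : realType) (K : completeValuedFieldType R) (B : ultraBanachType K).
Local Notation op := (bop B).
Variable p : nat.
Hypotheses (p_prime : prime p) (p_lt1 : vabs (p%:R : K) < 1)
  (p_neq0 : p%:R != 0 :> K) (p_odd : p <> 2%N).
Local Notation r := (vabs (p%:R : K)).
Local Notation zp := (@zp R K p).

Lemma vpow_part_poly (s : K) N : exists Q : {poly K}, forall l, Q.[l] = vpow_part s l N.
Proof.
exists (\sum_(0 <= i < N) ((s - 1) ^+ i / i`!%:R) *: \prod_(j < i) ('X - j%:R%:P)) => l.
rewrite horner_sum; apply: eq_bigr => i _; rewrite hornerZ horner_prod /binom_poly.
rewrite mulrAC -mulrA; congr (_ * (_ / _)).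
by apply: eq_bigr => j _; rewrite !hornerE.
Qed.

Lemma zp_1D l : zp l -> zp (1 + l).
Proof.
by move=> lz k; have [m lm] := lz k; exists m.+1; rewrite -nat1r opprD addrACA subrr add0r.
Qed.

Lemma vpow_1p_inverse (S : set K) : (forall l, S l -> zp l /\ vabs l <= r) ->
  exists psi : K -> K, {within S, continuous psi} /\
    forall l, S l -> zp (psi l) /\ vpow (1 + p%:R) (psi l) = 1 + l.
Proof.
move=> Sr; pose psi l := xget 0 [set m | zp m /\ vpow (1 + p%:R) m = 1 + l].
have psiP l : S l -> zp (psi l) /\ vpow (1 + p%:R) (psi l) = 1 + l.
  move=> /Sr[lz lr].
  apply: (@xgetPex _ 0 [set m | zp m /\ vpow (1 + p%:R) m = 1 + l]).
  have [|m mz ml] := vpow_1p_surj p_prime p_lt1 p_neq0 p_odd (zp_1D lz); last by exists m.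
  by rewrite addrAC subrr add0r.
exists psi; split=> //; apply/within_continuousP => x Sx e e0.
have [k ke] := r_small p_lt1 p_neq0 e0.
exists (r ^+ k.+1); first by rewrite exprn_gt0// vabs_gt0.
move=> y Sy xy; have [xz xE] := psiP x Sx; have [yz yE] := psiP y Sy.
apply: le_lt_trans ke; apply: (vpow_1p_inj p_prime) => //.
by rewrite xE yE opprD addrACA subrr add0r ltW.
Qed.

(** The polynomials Q are the partial sums of the binomial series for
    (1 + p) ^ A; their uniform convergence shows that V lies in the closed
    algebra generated by A. *)
Lemma logarithm_exists (V : op) :
  strongly_normal V -> (forall l, spectrum V l -> zp l /\ vabs l <= r) ->
  exists A : op, [/\ strongly_normal A, forall m, spectrum A m -> zp m &
    forall N, exists2 Q : {poly K}, forall l, Q.[l] = vpow_part (1 + p%:R) l N &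
      unorm (1 + V - poly_op A Q) <= r ^+ N].
Proof.
move=> [[Vu Vc] V0 Vk _ [h [g [hM gM hK gK [hc gc he]]]]] Vr.
have Vz l : spectrum V l -> zp l by move=> /Vr[].
have he' l : spectrum V l -> h l (V - l *: (1 : op)) = 0 by exact: he.
have [psi [psic psiP]] := vpow_1p_inverse Vr.
have [A hA Apsi] := gelfand_surjective Vu V0 hM he gM gK p_prime p_lt1 p_neq0 Vz Vk psic.
have sr : vabs (1 + p%:R - 1 : K) <= r by rewrite addrAC subrr add0r.
have hV := @opalg_id R K B V; have h1 := @opalg1 R K B V.
have expA N : exists2 Q : {poly K}, forall l, Q.[l] = vpow_part (1 + p%:R) l N &
    unorm (1 + V - poly_op A Q) <= r ^+ N.
  have [Q QE] := vpow_part_poly (1 + p%:R) N; exists Q => //.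
  have hQ : opalg V (poly_op A Q).
    by apply: opalg_sum => i _; apply: opalgZ; exact: opalgX.
  have h1V := opalgD h1 hV.
  apply: (opnorm_le_gelfand Vu V0 hM he gM gK) => [|l sl]; first exact: opalgB.
  rewrite (gelfandB hM he)// (gelfandD hM he)// (gelfand1 hM)// (gelfand_id hM he)//.
  rewrite (gelfand_poly_op hM he)// Apsi//; have [pz <-] := psiP l sl.
  by rewrite QE (vpow_tail p_prime).
have AV : opalg A V.
  apply: opalg_closed => e e0; have [N Ne] := r_small p_lt1 p_neq0 e0.
  have [Q _ QV] := expA N; exists (poly_op A Q - 1).
    by apply: opalgB; [exact: opalg_poly | exact: opalg1].
  by rewrite opprB addrA [V + 1]addrC (le_trans QV)// ltW.
exists A; split=> //.
  exact: (strongly_normal_generator Vu V0 hM he gM gK p_prime p_lt1 p_neq0 Vz Vk Vc hK hc gc).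
move=> m; rewrite (spectrum_gelfand Vu V0 hM he gM gK p_prime p_lt1 p_neq0 Vz Vk hA).
by move=> [l sl <-]; rewrite Apsi//; have [] := psiP l sl.
Qed.

End Logarithm.

(** * One-parameter groups *)

Section UnitaryGroup.
Variables (R : realType) (Qp K : completeValuedFieldType R) (B : ultraBanachType K).
Local Notation op := (bop B).
Variable U : Qp -> op.
Hypothesis U_group : unitary_group U.
Local Notation units := (@principal_units R Qp).

Lemma principal_unitsP (s : Qp) : units s <-> vabs (s - 1) < 1.
Proof.
split=> [[z z1 <-]|s1]; first by rewrite addrAC subrr add0r.
by exists (s - 1) => //; rewrite addrC subrK.
Qed.

Lemma principal_units1 : units 1.
Proof. by apply/principal_unitsP; rewrite subrr vabs0. Qed.

Lemma principal_unitsX s n : units s -> units (s ^+ n).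
Proof.
move=> /principal_unitsP s1; apply/principal_unitsP.
have ss : vabs s <= 1 by apply: (vabs_le_dist (ltW s1)); rewrite vabs1.
by rewrite -[X in _ - X](expr1n Qp n) (le_lt_trans (vabs_subrXX _ ss _)) ?vabs1.
Qed.

(** An idempotent 1 + W with |W| < 1 is the identity: W = - W ^ 2. *)
Lemma unitary_group1 : U 1 = 1.
Proof.
have [Uu Um _] := U_group; have [W [_ W1 UE]] := Uu _ principal_units1.
have : U 1 * U 1 = U 1 by rewrite -Um ?mulr1//; exact: principal_units1.
rewrite UE mulrDl mul1r mulrDr mulr1 => /eqP; rewrite addrC -subr_eq0 addrK => /eqP WW.
have {WW} WE : W = - (W * W) by apply/eqP; rewrite -addr_eq0 WW.
have : unorm W <= unorm W * unorm W by rewrite {1}WE unormN opnormM.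
have := unorm_ge0 W; rewrite le_eqVlt => /predU1P[/esym/eqP|W0].
  by rewrite unorm_eq0 => /eqP -> _; rewrite addr0.
by rewrite -{1}[unorm W]mulr1 ler_pM2l// leNgt W1.
Qed.

Lemma unitary_groupX s n : units s -> U (s ^+ n) = U s ^+ n.
Proof.
have [_ Um _] := U_group; move=> su; elim: n => [|n IH]; first exact: unitary_group1.
by rewrite !exprS Um ?IH//; exact: principal_unitsX.
Qed.

Lemma unitary_group_continuous s (e : R) : units s -> 0 < e ->
  exists2 d : R, 0 < d & forall t, units t -> vabs (s - t) < d -> unorm (U s - U t) < e.
Proof.
have [_ _ /subspace_continuousP Uc] := U_group; move=> su e0.
have : within units (nbhs s) (U @^-1` ball (U s) e).
  by apply: (Uc s su); exact: nbhsx_ballx.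
by rewrite /within/= => /vnbhsP[d d0 dh]; exists d => // t tu st; exact: (dh t st tu).
Qed.

End UnitaryGroup.
Theorem mainTheorem1 (R : realType) (p : nat) (Qp K : completeValuedFieldType R)
    (iota : {rmorphism Qp -> K}) (B : ultraBanachType K) (U : Qp -> bop B)
    (p_prime : prime p) (p_neq2 : p <> 2%N)
    (Qp_padic : is_padic_field p Qp)
    (iota_isom : forall x : Qp, vabs (iota x) = vabs x)
    (U_group : unitary_group U)
    (U_spec : spectrum (U (1 + p%:R) - 1) `<=`
                iota @` [set p%:R * x | x in @padic_int R Qp]) :
  exists A : bop B,
    [/\ strongly_normal A,
        spectrum A `<=` iota @` @padic_int R Qp &
        forall s, @principal_units R Qp s ->
          op_fun_calc A (vpow (iota s)) (U s)].
Proof.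
have q_lt1 := padic_p_lt1 p_prime Qp_padic.
have q_neq0 := padic_p_neq0 p_prime Qp_padic.
have p_lt1 := padic_p_lt1K p_prime Qp_padic iota_isom.
have p_neq0 := padic_p_neq0K p_prime Qp_padic iota_isom.
have rE : vabs (p%:R : K) = vabs (p%:R : Qp) := vabs_natK iota_isom p.
have iota_sub1 s : vabs (iota s - 1) = vabs (s - 1).
  by rewrite -(rmorph1 iota) -rmorphB iota_isom.
have unit_le s : @principal_units R Qp s -> vabs (s - 1) <= vabs (p%:R : Qp).
  by move=> /principal_unitsP; exact: padic_lt1_le.
have unit_1p : @principal_units R Qp (1 + p%:R).
  by apply/principal_unitsP; rewrite addrAC subrr add0r.
have [Uu _ _] := U_group; have [V [Vn _ UV]] := Uu _ unit_1p.
have V_spec l : spectrum V l -> zp p l /\ vabs l <= vabs (p%:R : K).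
  have -> : V = U (1 + p%:R) - 1 by rewrite UV addrAC subrr add0r.
  move=> /U_spec[_ [x x1 <-] <-].
  have px : vabs (p%:R * x) <= vabs (p%:R : Qp) by rewrite vabsM ler_piMr ?vabs_ge0.
  split; last by rewrite iota_isom rE.
  apply: (iota_zp p_prime Qp_padic iota_isom).
  by rewrite /padic_int/= (le_trans px)// ltW.
have [A [An Az VA]] := logarithm_exists p_prime p_lt1 p_neq0 p_neq2 Vn V_spec.
exists A; split=> //.
  by move=> m /Az /(zp_iota p_prime Qp_padic iota_isom)[x x1 <-]; exists x.
have [[Au Ac] A0 Ak _ [h [g [hM gM hK gK [hc gc he]]]]] := An.
have iso := gelfand_spectral_iso Au A0 hM he gM gK p_prime p_lt1 p_neq0 Az Ak.
have r1 : vabs (1 + p%:R - 1 : K) <= vabs (p%:R : K) by rewrite addrAC subrr add0r.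
have hV1 : opalg A (1 + V).
  apply: opalg_closed => e e0; have [N Ne] := r_small p_lt1 p_neq0 e0.
  have [Q _ QV] := VA N; exists (poly_op A Q); first exact: opalg_poly.
  by rewrite (le_trans QV)// ltW.
(* both sides are the limit of the values at m of the binomial series *)
have gV m : spectrum A m -> gelfand h (1 + V) m = vpow (1 + p%:R) m.
  move=> sm; apply/eqP; rewrite -subr_eq0; apply/eqP; apply: vabs_small_eq0 => e e0.
  have [N Ne] := r_small p_lt1 p_neq0 e0; have [Q QE QV] := VA N.
  apply: le_trans (ltW Ne); have hQ := @opalg_poly R K B A Q.
  apply: (@vdist_trans _ _ (gelfand h (poly_op A Q) m)).
    rewrite -(gelfandB hM he)//; apply: le_trans QV.
    by apply: (gelfand_le_norm hM he) => //; exact: opalgB.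
  by rewrite (gelfand_poly hM he)// QE vdistC (vpow_tail p_prime)//; exact: Az.
(* U s is a limit of powers of U (1 + p), by the density of the powers of 1 + p *)
have U_approx s (e : R) : @principal_units R Qp s -> 0 < e ->
    exists n, unorm (U s - (1 + V) ^+ n) <= e /\ vabs ((1 + p%:R) ^+ n - s) <= e.
  move=> su e0; have [d d0 dh] := unitary_group_continuous U_group su e0.
  have m0 : 0 < Num.min d e by rewrite lt_min d0.
  have [k ke] := r_small q_lt1 q_neq0 m0.
  have s1 : vabs s <= 1.
    by apply: (@vabs_le_dist _ _ _ _ 1); rewrite ?vabs1// (le_trans (unit_le s su))// ltW.
  have sz := padic_int_zp p_prime Qp_padic s1.
  have [n ns] := expr1p_dense p_prime q_lt1 q_neq0 p_neq2 k sz (unit_le s su).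
  have {}ns : vabs ((1 + p%:R) ^+ n - s) < Num.min d e.
    by rewrite (le_lt_trans ns)// (le_lt_trans _ ke)// exprn_ile1_le ?vabs_ge0// ltW.
  move: ns; rewrite lt_min => /andP[nd ne]; exists n; split; last exact: ltW.
  rewrite -UV -(unitary_groupX U_group)// ltW// dh//; last by rewrite vdistC.
  exact: principal_unitsX.
move=> s su.
have hUs : opalg A (U s).
  apply: opalg_closed => e e0; have [n [Un _]] := U_approx s e su e0.
  by exists ((1 + V) ^+ n) => //; exact: opalgX.
have sr : vabs (iota s - 1) <= vabs (p%:R : K) by rewrite iota_sub1 rE unit_le.
exists (gelfand h) => //; split; [|split] => //.
  apply/within_continuousP => x /Az xz e e0; have e20 : 0 < e / 2 by rewrite divr_gt0.
  have [d d0 dh] := vpow_uniformly_continuous p_prime p_lt1 p_neq0 sr e20.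
  exists d => // y /Az yz xy; apply: (@le_lt_trans _ _ (e / 2)).
    by apply: dh => //; exact: ltW.
  by rewrite ltr_pdivrMr// ltr_pMr// ltr1n.
move=> m sm; apply/eqP; rewrite -subr_eq0; apply/eqP; apply: vabs_small_eq0 => e e0.
have [n [Un ns]] := U_approx s e su e0.
have hVn := opalgX (n := n) hV1.
apply: (@vdist_trans _ _ (gelfand h ((1 + V) ^+ n) m)).
  rewrite -(gelfandB hM he)//; apply: le_trans Un.
  by apply: (gelfand_le_norm hM he) => //; exact: opalgB.
rewrite (gelfandX hM he)// gV// -(vpow_expr p_prime p_lt1 p_neq0 n r1 (Az m sm)).
apply: le_trans ns; rewrite -iota_isom rmorphB rmorphXn rmorphD rmorph1 rmorph_nat.
apply: (vpow_base_lipschitz p_prime p_lt1 p_neq0) => //; last exact: Az.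
exact: vabs_expr_sub1.
Qed.
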